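(* Define for a prime $p\ge5$ $$S(r,p)=-\left(\frac{-1}{p}\right)\frac{\sqrt p}{2^{r+2}}\sum_{j=1}^{p-1}\left(\frac{j}{p}\right)\cot^{(r)}\left(\frac{\pi j}{p}\right)$$ and $$T(r,p)=(-1)^{[(r-1)/2]}\frac{p^{r+1}}{2(r+1)}\sum_{j=1}^{p-1}\left(\frac{j}{p}\right)B_{r+1}\left(\frac{j}{p}\right).$$ Then for $(p,r+1)=1$ both $S(r,p)$ and $T(r,p)$ are nonnegative integers, and they are equal.
   Context: $(p,r+1)$ denotes the greatest common divisor. $\left(\frac{a}{p}\right)$ is the Legendre symbol. $[x]$ is the integer part (floor) of $x$. $\cot^{(r)}$ is the $r$-th derivative of the cotangent function, so $r$ is an order of differentiation. $B_n(x)$ is the $n$-th Bernoulli polynomial, defined by $\frac{te^{xt}}{e^t-1}=\sum_{n\ge0}B_n(x)\frac{t^n}{n!}$.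
   Formalization: The order r is taken to be at least 1; for r = 0 the claim fails, e.g. p = 7 gives S(0,7) = T(0,7) = 7/2, which is not an integer. *)

(* Defs.v *)
From HB Require Import structures.
From mathcomp Require Import all_boot all_order all_algebra.
From mathcomp Require Import all_classical all_reals all_analysis.
From mathcomp Require Import ring lra.
Set Implicit Arguments.
Unset Strict Implicit.
Unset Printing Implicit Defensive.
Import Order.TTheory GRing.Theory Num.Theory.
Import numFieldNormedType.Exports.
Local Open Scope classical_set_scope.
Local Open Scope ring_scope.

Definition legendre (a : int) (p : nat) : int :=
  if (p %| a)%Z then 0
  else if [exists x : 'I_p, (x%:Z ^+ 2 == a %[mod p])%Z] then 1 else -1.

Definition cot (R : realType) (x : R) : R := cos x / sin x.

(* The generating function t e^(xt) / (e^t - 1) of the B_n(x) has a removable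
   singularity at t = 0, hence the punctured neighbourhood.  This determines
   B uniquely; existence is [is_bernoulli_poly_exists] below. *)
Definition is_bernoulli_poly (R : realType) (B : nat -> {poly R}) : Prop :=
  forall x : R, \forall t \near (0 : R)^',
    pseries (fun n => (B n).[x] / n`!%:R) t @ \oo -->
      t * expR (x * t) / (expR t - 1).

Definition Ssum (R : realType) (r p : nat) : R :=
  - (legendre (-1) p)%:~R * (Num.sqrt p%:R / 2 ^+ (r + 2)) *
  \sum_(1 <= j < p)
    (legendre j p)%:~R * derive1n r (@cot R) (pi * j%:R / p%:R).

(* For r > 0, the truncated quotient [(r - 1) %/ 2] is the integer part of
   (r - 1) / 2. *)
Definition Tsum (R : realType) (B : nat -> {poly R}) (r p : nat) : R :=
  (-1) ^+ ((r - 1) %/ 2) * (p%:R ^+ (r + 1) / (2 * (r + 1)%:R)) *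
  \sum_(1 <= j < p) (legendre j p)%:~R * (B (r + 1)%N).[j%:R / p%:R].

Section Existence.
Variable R : realType.
Implicit Types (x t : R) (n N k : nat).

(* Coefficients of (e^t - 1) / t. *)
Let eps n : R := (n.+1)`!%:R^-1.

Let cs n : seq R :=
  iter n (fun s => rcons s ((size s == 0)%:R -
     \sum_(k < size s) s`_k * eps (size s - k))) [::].

(* Coefficients of t / (e^t - 1), by power series inversion. *)
Let c n : R := (cs n.+1)`_n.

Let size_cs n : size (cs n) = n.
Proof. by elim: n => //= n IH; rewrite size_rcons IH. Qed.

Let nth_cs n k : (k < n)%N -> (cs n)`_k = c k.
Proof.
elim: n => // n IH; rewrite ltnS leq_eqVlt => /orP[/eqP->//|kn].
by rewrite /= nth_rcons size_cs kn IH.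
Qed.

Let cE n : c n = (n == 0)%:R - \sum_(k < n) c k * eps (n - k).
Proof.
rewrite /c /= nth_rcons size_cs ltnn eqxx; congr (_ - _).
by apply: eq_bigr => k _; rewrite nth_cs.
Qed.

Let eps_ge0 n : 0 <= eps n. Proof. by rewrite invr_ge0. Qed.

Let eps_le n : eps n <= 2^-1 ^+ n.
Proof.
rewrite /eps exprVn lef_pV2 ?posrE ?ltr0n ?fact_gt0 ?exprn_gt0//.
rewrite -natrX ler_nat; elim: n => // n IH.
by rewrite expnS factS leq_mul.
Qed.

Let sum_half n : \sum_(k < n) (2^-1 : R) ^+ k.+1 = 1 - 2^-1 ^+ n.
Proof.
elim: n => [|n IH]; first by rewrite big_ord0 expr0 subrr.
rewrite big_ord_recr/= IH exprS; set a := _ ^+ n.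
by rewrite {1}(splitr a) (mulrC a); lra.
Qed.

Let c_le1 n : `|c n| <= 1.
Proof.
have [m] := ubnP n; elim: m n => // m IH [|n] nm.
  by rewrite cE big_ord0 subr0 normr1.
rewrite cE sub0r normrN.
apply: le_trans (ler_norm_sum _ _ _) _.
apply: (@le_trans _ _ (\sum_(k < n.+1) 2^-1 ^+ k.+1)); last first.
  by rewrite sum_half gerBl exprn_ge0.
rewrite [leRHS](reindex_inj rev_ord_inj)/=; apply: ler_sum => k _.
rewrite normrM (ger0_norm (eps_ge0 _)) -[leRHS]mul1r ler_pM//.
  by apply: IH; apply: leq_trans (ltn_ord k) _.
by rewrite subSS -subSn ?eps_le// -ltnS.
Qed.

Let B n : {poly R} := \poly_(i < n.+1) (n`!%:R / i`!%:R * c (n - i)).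

Let xc x n : R := x ^+ n / n`!%:R.

Let b x n : R := (B n).[x] / n`!%:R.

Let bE x n : b x n = \sum_(i < n.+1) xc x i * c (n - i).
Proof.
rewrite /b /B horner_poly mulr_suml; apply: eq_bigr => i _; rewrite /xc.
have fn : n`!%:R != 0 :> R by rewrite pnatr_eq0 -lt0n fact_gt0.
have fi : i`!%:R != 0 :> R by rewrite pnatr_eq0 -lt0n fact_gt0.
by field; rewrite fn fi.
Qed.

Let conv x N k : (k < N)%N ->
  ((\poly_(n < N) b x n) * \poly_(n < N) eps n)`_k = xc x k.
Proof.
move=> kN.
pose pc := \poly_(n < N) c n; pose px := \poly_(n < N) xc x n.
pose pe := \poly_(n < N) eps n.
have H1 i : (i < N)%N -> (pc * pe)`_i = (i == 0)%:R.
  move=> iN; rewrite coefM big_ord_recr/= subnn !coef_poly iN (leq_ltn_trans _ iN)//.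
  have -> : eps 0 = 1 by rewrite /eps invr1.
  rewrite mulr1 (eq_bigr (fun j : 'I_i => c j * eps (i - j))).
    by rewrite [c i]cE addrC subrK.
  move=> j _; rewrite !coef_poly (ltn_trans (ltn_ord j) iN).
  by rewrite (leq_ltn_trans (leq_subr _ _) iN).
have H2 i : (i < N)%N -> (\poly_(n < N) b x n)`_i = (px * pc)`_i.
  move=> iN; rewrite coef_poly iN bE coefM; apply: eq_bigr => j _.
  rewrite !coef_poly (leq_ltn_trans (leq_subr _ _) iN) (leq_ltn_trans _ iN)//.
  by rewrite -ltnS.
transitivity ((px * pc * pe)`_k).
  rewrite !coefM; apply: eq_bigr => i _; congr (_ * _); rewrite H2//.
  by apply: leq_ltn_trans kN; rewrite -ltnS.
rewrite -mulrA coefM big_ord_recr/= subnn H1 ?(leq_ltn_trans _ kN)// mulr1.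
rewrite big1 ?add0r ?coef_poly ?kN// => i _.
rewrite H1 ?(leq_ltn_trans (leq_subr _ _) kN)//.
by rewrite subn_eq0 leqNgt ltn_ord mulr0.
Qed.

Let b_le x n : `|b x n| <= expR `|x|.
Proof.
rewrite bE; apply: le_trans (ler_norm_sum _ _ _) _.
apply: (@le_trans _ _ (series (exp_coeff `|x|) n.+1)); last first.
  rewrite /expR; apply: nondecreasing_cvgn_le.
    by apply: nondecreasing_series => i _ _; exact: exp_coeff_ge0.
  exact: is_cvg_series_exp_coeff.
rewrite /series/= big_mkord; apply: ler_sum => i _.
rewrite normrM -[leRHS]mulr1 ler_pM// /xc /exp_coeff/=.
by rewrite normrM normrX normfV normr_nat.
Qed.

Let tail x t N : `|t| <= 2^-1 ->
  `|(\sum_(n < N) b x n * t ^+ n) * (\sum_(n < N) eps n * t ^+ n) -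
    \sum_(n < N) xc x n * t ^+ n| <= expR `|x| * 4 * 2^-1 ^+ N.
Proof.
move=> t2; rewrite -!horner_poly -hornerM.
set p := \poly_(n < N) b x n; set q := \poly_(n < N) eps n.
have szpq : (size (p * q)%R <= N + N)%N.
  apply: leq_trans (size_polyMleq _ _) _.
  by rewrite (leq_trans (leq_pred _))// leq_add ?size_poly.
rewrite (horner_coef_wide _ szpq) horner_poly big_split_ord/=.
under eq_bigr do rewrite conv ?ltn_ord//.
rewrite addrAC subrr add0r; apply: le_trans (ler_norm_sum _ _ _) _.
have cpq k : `|(p * q)`_k| <= expR `|x| * 2.
  rewrite coefM; apply: le_trans (ler_norm_sum _ _ _) _.
  apply: (@le_trans _ _ (\sum_(i < k.+1) expR `|x| * (2 * 2^-1 ^+ i.+1))).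
    rewrite [leRHS](reindex_inj rev_ord_inj)/=; apply: ler_sum => i _.
    rewrite normrM ler_pM//.
      by rewrite coef_poly; case: ifP => _; rewrite ?b_le// normr0 expR_ge0.
    rewrite exprS mulrA divff ?pnatr_eq0// mul1r subSS coef_poly.
    by case: ifP => _; rewrite ?normr0 ?exprn_ge0// ger0_norm.
  rewrite -!mulr_sumr sum_half.
  have : 0 <= expR `|x| * (2^-1 : R) ^+ k.+1.
    by rewrite mulr_ge0 ?expR_ge0 ?exprn_ge0.
  lra.
apply: (@le_trans _ _
  (\sum_(i < N) expR `|x| * 2 * (2^-1 ^+ N * (2 * 2^-1 ^+ i.+1)))).
  apply: ler_sum => i _; rewrite normrM ler_pM// normrX.
  rewrite [2^-1 ^+ i.+1]exprS (mulrA 2) divff ?pnatr_eq0// mul1r -exprD.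
  by rewrite lerXn2r ?nnegrE.
rewrite -!mulr_sumr sum_half.
have : (2^-1 : R) ^+ N >= 0 by rewrite exprn_ge0.
have := expR_gt0 `|x|; set e := expR _; set a := _ ^+ N => e0 a0.
have : 0 <= e * a * a by rewrite !mulr_ge0// ltW.
lra.
Qed.

Let cvg_b x t : t != 0 -> `|t| <= 2^-1 ->
  pseries (b x) t @ \oo --> t * expR (x * t) / (expR t - 1).
Proof.
move=> t0 t2.
have et0 : expR t - 1 != 0 by rewrite subr_eq0 -expR0 (inj_eq (@expR_inj R)).
pose P N := \sum_(n < N) b x n * t ^+ n.
pose E N := \sum_(n < N) eps n * t ^+ n.
pose X N := \sum_(n < N) xc x n * t ^+ n.
have cX : X @ \oo --> expR (x * t).
  have -> : X = series (exp_coeff (x * t)).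
    apply/funext => N; rewrite /X /series/= big_mkord; apply: eq_bigr => i _.
    by rewrite /xc /exp_coeff/= exprMn mulrAC.
  exact: is_cvg_series_exp_coeff.
have cE' : E @ \oo --> (expR t - 1) / t.
  have -> : E = fun N => (series (exp_coeff t) (N + 1)%N - 1) / t.
    apply/funext => N; rewrite /E /series/= big_mkord addn1 big_ord_recl.
    rewrite /exp_coeff/= expr0 fact0 divr1 addrC addKr mulr_suml.
    apply: eq_bigr => i _; rewrite /bump/= /eps exprS; field.
    by rewrite t0 pnatr_eq0 -lt0n fact_gt0.
  apply: cvgMl; apply: cvgB; last exact: cvg_cst.
  have := is_cvg_series_exp_coeff t.
  by rewrite -[X in X -> _](cvg_shiftn 1%N).
have cD : (fun N => P N * E N - X N) @ \oo --> 0.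
  apply/norm_cvg0P; apply: (@squeeze_cvgr _ _ _ _ (cst 0)
      (fun N => expR `|x| * 4 * 2^-1 ^+ N)).
  - by apply: nearW => N; rewrite normr_ge0/= tail.
  - exact: cvg_cst.
  - by apply: cvg_geometric; rewrite ger0_norm// invf_lt1// ltr1n.
have cPE : (fun N => P N * E N) @ \oo --> expR (x * t).
  have -> : (fun N => P N * E N) = (fun N => (P N * E N - X N) + X N).
    by apply/funext => N; rewrite subrK.
  by rewrite -[expR (x * t)]add0r; exact: cvgD.
have Et0 : (expR t - 1) / t != 0 by rewrite mulf_neq0// invr_neq0.
have eqP : {near \oo, (fun N => P N * E N * (E N)^-1) =1 pseries (b x) t}.
  near=> N; rewrite /= mulfK; first by rewrite /P /pseries /series/= big_mkord.
  by near: N; exact: cvgr_neq0 cE' Et0.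
have := cvgM cPE (cvgV Et0 cE').
rewrite invf_div mulrA [expR _ * t]mulrC.
by move=> h; exact: (cvg_trans (near_eq_cvg _) (h _ _)).
Unshelve. all: by end_near. Qed.

Lemma is_bernoulli_poly_exists : exists B : nat -> {poly R}, is_bernoulli_poly B.
Proof.
exists B => x; near=> t; apply: cvg_b.
  by near: t; exact: nbhs_dnbhs_neq.
have t2 : `|t| < 2^-1.
  by near: t; apply: dnbhs0_lt; rewrite invr_gt0.
exact: ltW.
Unshelve. all: by end_near. Qed.
End Existence.

(* Main.v *)
Require Import Defs.
From HB Require Import structures.
From mathcomp Require Import all_boot all_order all_algebra all_field.
From mathcomp Require Import all_classical all_reals all_analysis.
From mathcomp Require Import complex.
From mathcomp Require Import ring lra zify.
Set Implicit Arguments.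
Unset Strict Implicit.
Unset Printing Implicit Defensive.
Import Order.TTheory GRing.Theory Num.Theory.
Import numFieldNormedType.Exports.
Local Open Scope classical_set_scope.
Local Open Scope ring_scope.

(** Write chi for the Legendre symbol mod p, m = (p - 1) / 2, z = e^(2 pi i / p)
    and G = sum_j chi(j) z^j.

    Equality up to the sign of G. For w with w^p = 1 and w <> 1, the identity
      sum_(0 <= k < p) w^k e^(kt) / (e^(pt) - 1) = 1 / (w e^t - 1)
    holds for the generating functions. Comparing coefficients, the finite
    Fourier transform of k |-> B_(r+1)(k/p) is, up to a factor, the value at
    y = 1 / (w - 1) of an integer polynomial E_r [geom_poly], the r-th iterate
    of the derivation -(X + X^2) d/dX on X ([bernoulli_dft]). At w = z^j one has
    y = -1/2 - (i/2) cot(pi j / p), and this affine change of variable turns E_r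
    into the polynomial which expresses the r-th derivative of cot in terms of
    cot ([geom_poly_cot], [derive1n_cot]). Multiplying by chi(j) and summing
    over j makes G appear on the Bernoulli side ([gauss_bernoulli_sum]), so that
    S and T agree as soon as G is known. If chi(-1) <> (-1)^(r+1) both sums
    vanish by the symmetry j |-> p - j.

    The Gauss sum. That G^2 = chi(-1) p leaves a sign, and the sign matters here.
    Kronecker's product prod_(1 <= k <= m) (w^k - w^(p-k)) has the same square,
    so it equals e G with e = 1 or -1. The difference of the two integer
    polynomials vanishes at a primitive p-th root of unity, hence is divisible
    by 1 + X + ... + X^(p-1), which is (X - 1)^(p-1) mod p; comparing the
    coefficients of (X - 1)^m mod p gives e ([gauss_sine]). At w = -e^(pi i / p)
    the product consists of sines of known sign, whence G = sqrt p or
    G = i sqrt p ([gauss_value]).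

    Nonnegativity of S. Up to the sign (-1)^r the r-th derivative of cot at x is
    (1 + c^2) g(c) with c = cot x and g a polynomial with nonnegative
    coefficients. Hence the term j = 1 dominates the sum over j <= m as soon as
    sum_(2 <= j <= m) 1 / sin^2(jx) <= 1 / sin^2 x for x = pi / p, and this
    follows by telescoping cot((j-1)x) - cot(jx) ([sum_csc2_le],
    [cot_sum_ge0]).

    Integrality of T. Away from p: T is up to sign G times the sum over j <= m
    of chi(j) E_r(y_j), and p y_j lies in Z[z], so p^(r+1) T lies in the
    intersection of Z[z] with the rationals, which is Z ([zint_Tsum],
    [zint_rat_int]). At p: the recursion for the Bernoulli polynomials shows
    that p^n B_n(j/p) is p-integral, because p^e / (e + 1) is, and p does not
    divide 2 (r + 1) ([loc_int_Tsum]). *)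

(** * Power series and Bernoulli polynomials *)

Section PowerSeries.
Variable R : realType.
Implicit Types (f g : R -> R) (a b : nat -> R) (p : {poly R}).

(** Asymptotic expansion to all orders at 0. It is all that convergence of a
    power series is used for: it can be checked on finite truncations, so
    products need no rearrangement of infinite sums. *)
Definition has_expansion f a := forall n, exists K,
  \forall t \near (0 : R)^', `|f t - \sum_(k < n) a k * t ^+ k| <= K * `|t| ^+ n.

Lemma pseries_bound a (t0 l : R) : pseries a t0 @ \oo --> l ->
  exists2 M, 0 <= M & forall k, `|a k| * `|t0| ^+ k <= M.
Proof.
move=> cv.
have c0 : cvgn (fun k => a k * t0 ^+ k).
  apply/cvg_ex; exists 0; apply: cvg_series_cvg_0.
  by apply/cvg_ex; exists l.
have [M [_ /(_ (M + 1))]] := cvg_seq_bounded c0.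
rewrite ltrDl ltr01 => /(_ isT) HM; exists (M + 1).
  exact: le_trans (normr_ge0 _) (HM 0%N I).
by move=> k; have := HM k I; rewrite /= normrM normrX.
Qed.

Lemma sum_half_le n N : (n <= N)%N ->
  \sum_(n <= k < N) (2^-1 : R) ^+ k <= 2 * 2^-1 ^+ n.
Proof.
move=> nN; suff -> : \sum_(n <= k < N) (2^-1 : R) ^+ k = 2 * 2^-1 ^+ n - 2 * 2^-1 ^+ N.
  by rewrite gerBl mulr_ge0 ?exprn_ge0 ?invr_ge0.
elim: N nN => [|N IH]; first by rewrite leqn0 => /eqP->; rewrite big_geq// subrr.
rewrite leq_eqVlt => /orP[/eqP<-|]; first by rewrite big_geq// subrr.
rewrite ltnS => nN; rewrite big_nat_recr//= IH// [2^-1 ^+ N.+1]exprS.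
by field.
Qed.

Lemma pseries_has_expansion f a :
  (\forall t \near (0 : R)^', pseries a t @ \oo --> f t) -> has_expansion f a.
Proof.
move=> cv n.
have [t0 [t0N cv0]] : exists t0 : R, t0 != 0 /\ pseries a t0 @ \oo --> f t0.
  apply: (@filter_ex _ (0:R)^').
  by near=> t; split; [near: t; exact: nbhs_dnbhs_neq|near: t].
have [M M0 HM] := pseries_bound cv0.
have d0 : 0 < `|t0| by rewrite normr_gt0.
exists (2 * M / `|t0| ^+ n * 2 ^+ n * 2^-1 ^+ n); near=> t.
have tl : `|t| < `|t0| / 2 by near: t; apply: dnbhs0_lt; rewrite divr_gt0.
have cvt : pseries a t @ \oo --> f t by near: t.
pose S : R := \sum_(k < n) a k * t ^+ k.
have cvS : (fun N => `|pseries a t N - S|) @ \oo --> `|f t - S|.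
  by apply: cvg_norm; apply: cvgB => //; exact: cvg_cst.
apply: (cvgr_to_le cvS).
near=> N.
have nN : (n <= N)%N by near: N; exact: nbhs_infty_ge.
rewrite /pseries /series/= (big_cat_nat (leq0n n) nN)//= big_mkord.
  rewrite -/S [X in `|X|]addrC addKr.
apply: le_trans (ler_norm_sum _ _ _) _.
set q := `|t| / `|t0|.
have q2 : q <= 2^-1 by rewrite /q ler_pdivrMr// mulrC ltW.
have q0 : 0 <= q by rewrite divr_ge0.
apply: (@le_trans _ _ (\sum_(n <= k < N) M * (q ^+ n * 2 ^+ n) * 2^-1 ^+ k)).
  rewrite big_nat [leRHS]big_nat; apply: ler_sum => k /andP[nk _].
  have -> : `|a k * t ^+ k| = `|a k| * `|t0| ^+ k * q ^+ k.
    rewrite normrM normrX /q expr_div_n; field.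
    by rewrite expf_eq0 normr_eq0 (negbTE t0N) andbF.
  rewrite -[leRHS]mulrA; apply: ler_pM; rewrite ?mulr_ge0 ?exprn_ge0//.
  (* The first n factors of q are kept as a power of t; the others are at most 1/2. *)
  have -> : k = (n + (k - n))%N by rewrite subnKC.
  rewrite !exprD -mulrA ler_wpM2l ?exprn_ge0//.
  rewrite mulrA exprVn divff ?expf_neq0 ?pnatr_eq0// mul1r.
  by rewrite lerXn2r ?nnegrE ?invr_ge0.
rewrite -mulr_sumr.
apply: le_trans (ler_wpM2l _ (sum_half_le nN)) _.
  by rewrite !mulr_ge0// exprn_ge0.
rewrite /q expr_div_n le_eqVlt; apply/orP; left; apply/eqP; ring.
Unshelve. all: by end_near. Qed.

Lemma horner_bounded p : exists K : R, \forall t \near (0 : R)^', `|p.[t]| <= K.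
Proof.
exists (\sum_(i < size p) `|p`_i|); near=> t.
have t1 : `|t| < 1 by near: t; exact: dnbhs0_lt.
rewrite horner_coef; apply: le_trans (ler_norm_sum _ _ _) _.
apply: ler_sum => i _; rewrite normrM ler_piMr// normrX.
by rewrite exprn_ile1// ltW.
Unshelve. all: by end_near. Qed.

Definition conv a b n := \sum_(i < n.+1) a i * b (n - i)%N.

Lemma has_expansion_bounded f a : has_expansion f a ->
  exists K, \forall t \near (0 : R)^', `|f t| <= K.
Proof.
move=> /(_ 0%N)[K HK]; exists K; apply: filterS HK => t.
by rewrite big_ord0 subr0 expr0 mulr1.
Qed.

(** Only the truncations of both series at order n matter: the remaining
    terms of their product are divisible by t ^+ n. *)
Lemma has_expansionM f g a b : has_expansion f a -> has_expansion g b ->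
  has_expansion (fun t => f t * g t) (conv a b).
Proof.
move=> fa gb n.
pose p := \poly_(k < n) a k; pose q := \poly_(k < n) b k.
have [K1 H1] := fa n; have [K2 H2] := gb n.
have [K3 H3] := has_expansion_bounded gb.
have [K4 H4] := horner_bounded p.
have [K5 H5] := horner_bounded (drop_poly n (p * q)).
exists (K1 * K3 + K4 * K2 + K5); near=> t.
have -> : \sum_(k < n) conv a b k * t ^+ k = (take_poly n (p * q)).[t].
  rewrite /take_poly horner_poly; apply: eq_bigr => k _; congr (_ * _).
  rewrite coefM; apply: eq_bigr => i _.
  by rewrite !coef_poly (leq_ltn_trans (leq_subr _ _) (ltn_ord k))
     (leq_ltn_trans _ (ltn_ord k))// -ltnS.
have -> : f t * g t - (take_poly n (p * q)).[t] =
    (f t - p.[t]) * g t + p.[t] * (g t - q.[t]) + (drop_poly n (p * q)).[t] * t ^+ n.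
  have := congr1 (horner^~ t) (poly_take_drop n (p * q)).
  rewrite !hornerE => E.
  have -> : (drop_poly n (p * q)).[t] * t ^+ n = p.[t] * q.[t] - (take_poly n (p * q)).[t].
    by rewrite -E addrAC subrr add0r.
  by ring.
have h1 : `|f t - p.[t]| <= K1 * `|t| ^+ n by rewrite horner_poly; near: t.
have h2 : `|g t - q.[t]| <= K2 * `|t| ^+ n by rewrite horner_poly; near: t.
have h3 : `|g t| <= K3 by near: t.
have h4 : `|p.[t]| <= K4 by near: t.
have h5 : `|(drop_poly n (p * q)).[t]| <= K5 by near: t.
apply: le_trans (ler_normD _ _) _.
rewrite [leRHS]mulrDl; apply: lerD; last first.
  by rewrite normrM normrX ler_wpM2r// exprn_ge0.
rewrite [leRHS]mulrDl.
apply: le_trans (ler_normD _ _) _; apply: lerD; rewrite normrM.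
  by rewrite mulrAC ler_pM.
by rewrite -mulrA ler_pM.
Unshelve. all: by end_near. Qed.

(** At the first index n where the coefficients could differ, the two
    expansions bound (a n - b n) t^n by a multiple of t^(n+1). *)
Lemma has_expansion_uniq f a b :
  has_expansion f a -> has_expansion f b -> a =1 b.
Proof.
move=> fa fb n; have [m] := ubnP n; elim: m n => // m IH n nm.
have [K1 H1] := fa n.+1; have [K2 H2] := fb n.+1.
apply/eqP; rewrite -subr_eq0 -normr_le0; apply/ler_addgt0Pl => e e0.
rewrite addr0.
have [t [t0 [h1 [h2 te]]]] : exists t : R, t != 0 /\
   (`|f t - \sum_(k < n.+1) a k * t ^+ k| <= K1 * `|t| ^+ n.+1 /\
   (`|f t - \sum_(k < n.+1) b k * t ^+ k| <= K2 * `|t| ^+ n.+1 /\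
   `|t| < e / (`|K1| + `|K2| + 1))).
  apply: (@filter_ex _ (0:R)^'); near=> t; split; first by near: t; exact: nbhs_dnbhs_neq.
  split; first by near: t.
  split; first by near: t.
  near: t; apply: dnbhs0_lt; rewrite divr_gt0// ltr_wpDl// addr_ge0//.
have E : (a n - b n) * t ^+ n = (f t - \sum_(k < n.+1) b k * t ^+ k) -
    (f t - \sum_(k < n.+1) a k * t ^+ k).
  rewrite !big_ord_recr/= (eq_bigr (fun i : 'I_n => a i * t ^+ i)); first by ring.
  by move=> i _; rewrite IH// (leq_trans (ltn_ord i)).
have tn0 : 0 < `|t| ^+ n by rewrite exprn_gt0 ?normr_gt0.
rewrite -(ler_pM2r tn0) -normrX -normrM E.
apply: le_trans (ler_normB _ _) _.
apply: le_trans (lerD h2 h1) _.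
rewrite -mulrDl exprS mulrA normrX ler_wpM2r ?exprn_ge0//.
have D0 : 0 < `|K1| + `|K2| + 1 by rewrite ltr_wpDl// addr_ge0.
move: te; rewrite ltr_pdivlMr// => te.
apply: le_trans (ltW te); rewrite mulrC ler_wpM2l//.
by have := ler_norm K1; have := ler_norm K2; lra.
Unshelve. all: by end_near. Qed.

Lemma has_expansion_near f g a : (\forall t \near (0 : R)^', f t = g t) ->
  has_expansion f a -> has_expansion g a.
Proof.
move=> fg fa n; have [K HK] := fa n; exists K.
by apply: filterS2 fg HK => t ->.
Qed.

Lemma has_expansionB f g a b : has_expansion f a -> has_expansion g b ->
  has_expansion (fun t => f t - g t) (fun n => a n - b n).
Proof.
move=> fa gb n; have [K1 H1] := fa n; have [K2 H2] := gb n.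
exists (K1 + K2); apply: filterS2 H1 H2 => t h1 h2.
rewrite (eq_bigr (fun k : 'I_n => a k * t ^+ k - b k * t ^+ k)); last first.
  by move=> k _; rewrite mulrBl.
rewrite sumrB mulrDl; apply: le_trans (lerD h1 h2); apply: le_trans (ler_normB _ _).
by rewrite le_eqVlt; apply/orP; left; apply/eqP; congr `|_|; ring.
Qed.

Lemma has_expansion_id : has_expansion (@idfun R) (fun n => (n == 1)%:R).
Proof.
case=> [|[|n]]; exists 1; near=> t; rewrite /= mul1r.
- rewrite big_ord0 subr0 expr0 ltW//; near: t; exact: dnbhs0_lt.
- by rewrite big_ord1 mul0r subr0.
- rewrite !big_ord_recl big1 ?mul1r ?mul0r ?add0r ?addr0 ?subrr ?normr0 ?exprn_ge0// => i _.
  by rewrite mul0r.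
Unshelve. all: by end_near. Qed.

Lemma has_expansion_expR (h : R) :
  has_expansion (fun t => expR (h * t)) (fun n => h ^+ n / n`!%:R).
Proof.
apply: pseries_has_expansion; apply: nearW => t.
have -> : pseries (fun n => h ^+ n / n`!%:R) t = series (exp_coeff (h * t)).
  by apply/funext => N; apply: eq_bigr => i _; rewrite /exp_coeff/= exprMn mulrAC.
exact: is_cvg_series_exp_coeff.
Qed.

End PowerSeries.

Section Bernoulli.
Variables (R : realType) (B : nat -> {poly R}).
Hypothesis hB : is_bernoulli_poly B.
Implicit Types (x h : R) (n : nat).

Let gen x (t : R) := t * expR (x * t) / (expR t - 1).

Let genE x : has_expansion (gen x) (fun n => (B n).[x] / n`!%:R).
Proof. exact: pseries_has_expansion. Qed.

Let factN0 n : n`!%:R != 0 :> R.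
Proof. by rewrite pnatr_eq0 -lt0n fact_gt0. Qed.

(** Multiplication of the generating function by e^(ht). *)
Lemma bernoulli_add n x h :
  (B n).[x + h] = \sum_(k < n.+1) 'C(n, k)%:R * (B k).[x] * h ^+ (n - k).
Proof.
have H : has_expansion (gen (x + h))
    (conv (fun n => (B n).[x] / n`!%:R) (fun n => h ^+ n / n`!%:R)).
  apply: has_expansion_near (has_expansionM (genE x) (has_expansion_expR h)).
  by apply: nearW => t; rewrite /gen mulrDl expRD; ring.
have := has_expansion_uniq (genE (x + h)) H n.
move/(congr1 (fun u => u * n`!%:R)); rewrite divfK// => ->.
rewrite /conv mulr_suml; apply: eq_bigr => k _.
have kn : (k <= n)%N by rewrite -ltnS.
by rewrite -(bin_fact kn) !natrM; field; rewrite !factN0.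
Qed.

(** The difference of the generating functions at x + 1 and x is t e^(xt). *)
Lemma bernoulli_diff n x : (B n).[x + 1] - (B n).[x] = n%:R * x ^+ n.-1.
Proof.
have H : has_expansion (fun t => gen (x + 1) t - gen x t)
    (conv (fun n => (n == 1)%:R) (fun n => x ^+ n / n`!%:R)).
  apply: has_expansion_near (has_expansionM (@has_expansion_id R) (has_expansion_expR x)).
  near=> t; rewrite /gen mulrDl mul1r expRD /=.
  have t0 : t != 0 by near: t; exact: nbhs_dnbhs_neq.
  have et0 : expR t - 1 != 0 by rewrite subr_eq0 -expR0 (inj_eq (@expR_inj R)).
  by field.
have := has_expansion_uniq (has_expansionB (genE (x + 1)) (genE x)) H n.
move/(congr1 (fun u => u * n`!%:R)); rewrite mulrBl !divfK// => ->.
case: n => [|n]; rewrite /conv; first by rewrite big_ord1/= !mul0r.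
rewrite 2!big_ord_recl big1 ?addr0 ?mul0r ?add0r ?mul1r => [|i _]; last by rewrite mul0r.
by rewrite /= subSS subn0 factS natrM; field.
Unshelve. all: by end_near. Qed.

Lemma bernoulli_rec n x :
  \sum_(k < n.+1) 'C(n.+1, k)%:R * (B k).[x] = n.+1%:R * x ^+ n.
Proof.
have := bernoulli_diff n.+1 x; rewrite bernoulli_add big_ord_recr/=.
rewrite subnn expr0 mulr1 binn mul1r addrK => <-.
by apply: eq_bigr => k _; rewrite expr1n mulr1.
Qed.

End Bernoulli.

(** * The Legendre symbol *)

Lemma odd_prime_half p : prime p -> (2 < p)%N -> p = p./2.*2.+1.
Proof.
move=> p_pr p_gt2; have := odd_double_half p.
by case: (even_prime p_pr) p_gt2 => [->//|->] _ /=; rewrite add1n.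
Qed.

Section LegendreSymbol.
Variable p : nat.
Hypothesis p_pr : prime p.
Hypothesis p_gt2 : (2 < p)%N.

Let m := p./2.

Let pE : p = m.*2.+1 := odd_prime_half p_pr p_gt2.

Lemma intr_Fp_eq0 (a : int) : (a%:~R == 0 :> 'F_p) = (p %| a)%Z.
Proof. by rewrite (dvdz_pcharf (pchar_Fp p_pr)). Qed.

Lemma natr_Fp_eq0 (k : nat) : (k%:R == 0 :> 'F_p) = (p %| k)%N.
Proof. exact: (intr_Fp_eq0 k). Qed.

Lemma Fp_natr_mod (k : nat) : ((k%:R : 'F_p) : nat) = (k %% p)%N.
Proof. exact: val_Fp_nat. Qed.

Lemma Fp_expf_pred (x : 'F_p) : x != 0 -> x ^+ m.*2 = 1.
Proof.
move=> x0; have := expf_card x; rewrite card_Fp//.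
have -> : x ^+ p = x * x ^+ m.*2 by rewrite -exprS -pE.
by move/eqP; rewrite -[X in _ == X]mulr1 (inj_eq (mulfI x0)) => /eqP.
Qed.

(** As a ^+ m is a square root of 1, the other possibility is a ^+ m = 1. But
    the m squares of 1, ..., m are already all the roots that 'X^m - 1 can
    have. *)
Lemma Fp_nonsquare_exp (a : 'F_p) : a != 0 -> (forall y, y ^+ 2 != a) -> a ^+ m = -1.
Proof.
move=> a0 nsq; have := Fp_expf_pred a0.
rewrite -mul2n mulnC exprM => /eqP; rewrite -subr_eq0 subr_sqr_1 mulf_eq0.
case/orP; last by rewrite addr_eq0 => /eqP.
rewrite subr_eq0 => /eqP am.
pose S := [seq (i%:R : 'F_p) ^+ 2 | i <- iota 1 m].
have P0 : ('X^m - 1 : {poly 'F_p}) != 0.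
  by rewrite -size_poly_gt0 size_XnsubC// lt0n; apply/eqP => m0; move: p_gt2; rewrite pE m0.
have := max_poly_roots P0 (rs := a :: S).
rewrite size_XnsubC /=; last by rewrite lt0n; apply/eqP => m0; move: p_gt2; rewrite pE m0.
rewrite size_map size_iota ltnn => H; exfalso; suff: false by []; apply: H.
  apply/andP; split; first by rewrite /root !hornerE am subrr.
  rewrite /S all_map; apply/allP => i; rewrite mem_iota => /andP[i0 im] /=.
  rewrite /root !hornerE -exprM mul2n Fp_expf_pred ?subrr//.
  rewrite natr_Fp_eq0; apply/negP => /(dvdn_leq i0).
  by have := pE; move: i0 im => /=; lia.
apply/andP; split.
  by apply/negP; rewrite /S => /mapP[i _ ai]; move: (nsq i%:R); rewrite -ai eqxx.
rewrite map_inj_in_uniq ?iota_uniq// => i j.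
rewrite !mem_iota => /andP[i0 im] /andP[j0 jm] /eqP.
rewrite eqf_sqr => /orP[|] /eqP.
  move/(congr1 val) => /=; rewrite !Fp_natr_mod !modn_small//; have := pE; lia.
move/eqP; rewrite -addr_eq0 -natrD natr_Fp_eq0.
have ij0 : (0 < i + j)%N by rewrite addn_gt0 i0.
by move=> /(dvdn_leq ij0); have := pE; move: im jm; lia.
Qed.

(** Euler's criterion. It is the source of the other properties of the
    symbol, since -1, 0 and 1 are distinct mod p. *)
Lemma legendre_Fp (a : int) : (legendre a p)%:~R = a%:~R ^+ m :> 'F_p.
Proof.
rewrite /legendre -intr_Fp_eq0; case: eqP => [->|/eqP a0].
  by rewrite expr0n; case: eqP => // m0; move: p_gt2; rewrite pE m0.
have sqE (x : nat) : (x%:Z ^+ 2 == a %[mod p])%Z = ((x%:R : 'F_p) ^+ 2 == a%:~R).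
  by rewrite eqz_mod_dvd -intr_Fp_eq0 rmorphB rmorphXn/= subr_eq0.
case: ifP => [/existsP[x]|/negbT].
  rewrite sqE => /eqP xa; rewrite -xa -exprM mul2n Fp_expf_pred//.
  by apply: contraNneq a0 => x0; rewrite -xa x0 expr0n.
rewrite negb_exists => /forallP nsq; rewrite Fp_nonsquare_exp// => y.
have yp : ((y : nat) < p)%N by rewrite -[X in (_ < X)%N](Fp_cast p_pr) ltn_ord.
by have := nsq (Ordinal yp); rewrite sqE /= natr_Zp.
Qed.

Lemma legendre_values (a : int) : legendre a p \in [:: -1; 0; 1].
Proof. by rewrite /legendre; case: ifP => // _; case: ifP. Qed.

Lemma sign_Fp_inj (u v : int) : u \in [:: -1; 0; 1] -> v \in [:: -1; 0; 1] ->
  u%:~R = v%:~R :> 'F_p -> u = v.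
Proof.
move=> uS vS /eqP; rewrite -subr_eq0 -rmorphB/= intr_Fp_eq0 /dvdz => h.
apply/eqP; rewrite -subr_eq0 -absz_eq0 -leqn0 leqNgt; apply/negP => h0.
have := dvdn_leq h0 h.
by move: uS vS p_gt2; rewrite !inE => /or3P[]/eqP-> /or3P[]/eqP-> /=; lia.
Qed.

Lemma legendre_mod (a b : int) : a%:~R = b%:~R :> 'F_p -> legendre a p = legendre b p.
Proof.
by move=> ab; apply: sign_Fp_inj; rewrite ?legendre_values// !legendre_Fp ab.
Qed.

Lemma legendreM (a b : int) : legendre (a * b) p = legendre a p * legendre b p.
Proof.
apply: sign_Fp_inj; rewrite ?legendre_values//.
  by have := legendre_values a; have := legendre_values b;
     rewrite !inE => /or3P[]/eqP-> /or3P[]/eqP->.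
by rewrite !rmorphM/= !legendre_Fp -exprMn -rmorphM.
Qed.

Lemma legendre1 : legendre 1 p = 1.
Proof.
by apply: sign_Fp_inj; rewrite ?legendre_values// legendre_Fp rmorph1 expr1n.
Qed.

Lemma legendre0 : legendre 0 p = 0.
Proof. by rewrite /legendre dvdz0. Qed.

Lemma legendreN1 : legendre (-1) p = (-1) ^+ m.
Proof.
apply: sign_Fp_inj; rewrite ?legendre_values// ?legendre_Fp ?rmorphXn//=.
by rewrite -signr_odd; case: (odd m).
Qed.

Lemma legendre_opp (j : nat) : (j <= p)%N ->
  legendre (p - j)%N p = legendre (-1) p * legendre j p.
Proof.
move=> jp; rewrite -legendreM; apply: legendre_mod.
by rewrite -subzn// rmorphB rmorphM rmorphN1 mulN1r/= [_%:~R](pchar_Fp_0 p_pr) sub0r.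
Qed.

Lemma legendre_sqr (a : nat) : ~~ (p %| a)%N -> legendre a p * legendre a p = 1.
Proof.
move=> pa; have : legendre a p != 0.
  have pa' : (p %| a%:Z)%Z = false by exact: negbTE.
  by rewrite /legendre pa'; case: ifP.
by have := legendre_values a; rewrite !inE => /or3P[]/eqP->.
Qed.

(** Otherwise 'X^m - 1 would vanish at all the 2m nonzero elements of 'F_p. *)
Lemma exists_nonresidue : exists2 a : nat, ~~ (p %| a)%N & legendre a p = -1.
Proof.
have [/existsP[x /andP[x0 xm]]|/existsPn H] :=
  boolP [exists x : 'F_p, (x != 0) && (x ^+ m != 1)].
  exists (x : nat).
    by rewrite -natr_Fp_eq0 natr_Zp.
  apply: sign_Fp_inj; rewrite ?legendre_values// legendre_Fp -pmulrn natr_Zp.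
  have := Fp_expf_pred x0.
  rewrite -mul2n mulnC exprM => /eqP; rewrite -subr_eq0 subr_sqr_1 mulf_eq0.
  by rewrite subr_eq0 (negbTE xm)/= addr_eq0 => /eqP.
have m0 : (0 < m)%N by rewrite lt0n; apply/eqP => m0; move: p_gt2; rewrite pE m0.
have P0 : ('X^m - 1 : {poly 'F_p}) != 0 by rewrite -size_poly_gt0 size_XnsubC.
have := max_poly_roots P0 (rs := rem 0 (enum 'F_p)).
rewrite size_XnsubC// size_rem ?mem_enum// -cardE card_Fp// => K.
exfalso; suff: (p.-1 < m.+1)%N by have := pE; lia.
apply: K; last by rewrite rem_uniq// enum_uniq.
apply/allP => x; rewrite mem_rem_uniq ?enum_uniq// => /andP[x0 _].
by rewrite /root !hornerE subr_eq0; have := H x; rewrite x0/= negbK.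
Qed.

(** Summing over 'F_p makes multiplication by a unit available as a change of
    variable. *)
Lemma big_Fp (A : nmodType) (F : nat -> A) :
  \sum_(0 <= j < p) F j = \sum_(x : 'F_p) F (x : nat).
Proof. by rewrite -[in LHS](Fp_cast p_pr) big_mkord. Qed.

Lemma big_legendre (A : pzRingType) (F : nat -> A) :
  \sum_(1 <= j < p) (legendre j p)%:~R * F j =
  \sum_(x : 'F_p) (legendre (x : nat) p)%:~R * F (x : nat).
Proof.
rewrite -(big_Fp (fun j => (legendre j p)%:~R * F j)) [RHS]big_ltn ?prime_gt0//.
by rewrite legendre0 mul0r add0r.
Qed.

Lemma natr_Fp_unit (a : nat) : ~~ (p %| a)%N -> (a%:R : 'F_p) != 0.
Proof. by rewrite natr_Fp_eq0. Qed.

Lemma sum_legendre_scale (A : pzRingType) (F : nat -> A) (a : nat) :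
  ~~ (p %| a)%N -> (forall k, F (k %% p)%N = F k) ->
  \sum_(x : 'F_p) (legendre (x : nat) p)%:~R * F (a * x)%N =
  (legendre a p)%:~R * \sum_(x : 'F_p) (legendre (x : nat) p)%:~R * F (x : nat).
Proof.
move=> pa HF; have a0 := natr_Fp_unit pa.
rewrite [in RHS](reindex_inj (mulfI a0)) mulr_sumr; apply: eq_bigr => x _.
have -> : nat_of_ord (a%:R * x : 'F_p)%R = ((a * x) %% p)%N.
  by rewrite -Fp_natr_mod natrM natr_Zp.
rewrite HF mulrA -rmorphM/=; congr (_%:~R * _).
have -> : legendre ((a * x) %% p)%N p = legendre (a * x)%N p.
  apply: legendre_mod; rewrite -!pmulrn; apply: val_inj => /=.
  by rewrite !Fp_natr_mod modn_mod.
by rewrite PoszM legendreM mulrA legendre_sqr// mul1r.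
Qed.

(** Scaling the variable by a nonresidue changes the sign of the sum. *)
Lemma sum_legendre0 : \sum_(x : 'F_p) legendre (x : nat) p = 0.
Proof.
have [a pa ha] := exists_nonresidue.
have := @sum_legendre_scale int (fun=> 1) a pa (fun _ => erefl).
rewrite ha (eq_bigr (fun x : 'F_p => legendre (x : nat) p)); last first.
  by move=> x _; rewrite mulr1 intz.
by rewrite mulN1r => /eqP; rewrite -addr_eq0 -mulr2n mulrn_eq0 => /eqP.
Qed.

End LegendreSymbol.

(** * Iterated derivations of polynomials *)

Section IteratedDerivation.
Implicit Types (r : nat).

(** The r-fold image of 'X under the derivation h d/dX. If c' = h(c), then the
    r-th derivative of c is the value of this polynomial at c. *)
Definition iter_derivation (A : nzRingType) (h : {poly A}) r : {poly A} :=
  iter r (fun q => h * q^`()) 'X.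

Lemma iter_derivationS (A : nzRingType) (h : {poly A}) r :
  iter_derivation h r.+1 = h * (iter_derivation h r)^`().
Proof. by []. Qed.

Lemma map_iter_derivation (A A' : nzRingType) (f : {rmorphism A -> A'}) h r :
  map_poly f (iter_derivation h r) = iter_derivation (map_poly f h) r.
Proof.
elim: r => [|r IH]; first exact: map_polyX.
by rewrite !iter_derivationS rmorphM/= -deriv_map IH.
Qed.

(** The substitution u = a + b X turns h d/du into k g d/dX when
    h(a + b X) = b k g. The constant term a only disappears after the first
    derivation, whence the condition on r. *)
Lemma iter_derivation_affine (F : fieldType) (h g : {poly F}) (a b k : F) r :
  b != 0 -> h \Po (a%:P + b *: 'X) = (b * k) *: g -> (0 < r)%N ->
  iter_derivation h r \Po (a%:P + b *: 'X) = (b * k ^+ r) *: iter_derivation g r.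
Proof.
move=> b0 hg; case: r => // r _; elim: r => [|r IH].
  by rewrite !iter_derivationS /iter_derivation/= !derivX !mulr1 expr1.
rewrite iter_derivationS comp_polyM hg.
have := congr1 (@deriv F) IH.
rewrite deriv_comp derivZ derivD derivC add0r derivZ derivX => H.
have -> : (iter_derivation h r.+1)^`() \Po (a%:P + b *: 'X) =
    k ^+ r.+1 *: (iter_derivation g r.+1)^`().
  apply: (scalerI b0); rewrite scalerA -H.
  by rewrite mulr_algr.
by rewrite -scalerAl -scalerAr scalerA [in RHS]iter_derivationS -mulrA -exprS.
Qed.

(** The successive derivatives of 1 / (w e^t - 1) at t = 0, as polynomials in
    y = 1 / (w - 1). *)
Definition geom_poly (A : nzRingType) : nat -> {poly A} := iter_derivation (- ('X + 'X^2)).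

(** With y = 1 / (w - 1) this is Leibniz' rule for the r-th derivative of
    (w e^t) / (w e^t - 1) = 1 + 1 / (w e^t - 1) at t = 0, multiplied by y. *)
Lemma geom_poly_binomial (A : comNzRingType) r :
  ('X + 1) * (\sum_(s < r.+1) geom_poly A s *+ 'C(r, s)) =
  'X * (geom_poly A r + (r == 0)%:R).
Proof.
elim: r => [|r IH]; first by rewrite big_ord1/= bin0 mulr1n mulrC.
set S := \sum_(_ < _) _ in IH.
have -> : \sum_(s < r.+2) geom_poly A s *+ 'C(r.+1, s) =
    S + - ('X + 'X^2) * S^`().
  rewrite /S raddf_sum /= mulr_sumr.
  rewrite [X in X + _](_ : _ = \sum_(s < r.+2) geom_poly A s *+ 'C(r, s)); last first.
    by rewrite [RHS]big_ord_recr/= bin_small// mulr0n addr0.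
  rewrite [in LHS]big_ord_recl [X in _ = X + _]big_ord_recl /= !bin0 -addrA.
  congr (_ + _); rewrite -big_split /=; apply: eq_bigr => s _.
  rewrite /bump/= add1n binS mulrnDr; congr (_ + _).
  by rewrite derivMn mulrnAr.
have := congr1 (@deriv A) IH.
rewrite !derivM derivD derivX derivC addr0 mul1r derivD mul1r.
have -> : ((r == 0)%:R : {poly A})^`() = 0 by case: (r == 0); rewrite ?derivC// (derivC 1).
rewrite addr0 => H.
have -> : geom_poly A r.+1 = - ('X + 'X^2) * (geom_poly A r)^`() by [].
rewrite /= addr0.
have X : ('X + 1) * S^`() = geom_poly A r + (r == 0)%:R + 'X * (geom_poly A r)^`() - S.
  by rewrite -H addrAC subrr add0r.
transitivity (('X + 1) * S - 'X * ('X + 1) * (('X + 1) * S^`())); first by ring.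
rewrite X; set G' := _^`().
rewrite [LHS](_ : _ = ('X + 1) * (('X + 1) * S) - 'X * ('X + 1) *
  (geom_poly A r + (r == 0)%:R + 'X * G')); last by ring.
by rewrite IH; ring.
Qed.

End IteratedDerivation.

(** * The finite Fourier transform of Bernoulli values *)

Section BernoulliDFT.
Variables (R : realType) (B : nat -> {poly R}).
Hypothesis hB : is_bernoulli_poly B.
Variables (F : numFieldType) (phi : {rmorphism R -> F}) (p : nat) (w : F).
Hypotheses (p_gt0 : (0 < p)%N) (w1 : w != 1) (wp : w ^+ p = 1).

Let y := (w - 1)^-1.
Let e s := (geom_poly F s).[y].
Let b n k := phi (B n).[k%:R / p%:R].

Let p0 : p%:R != 0 :> F. Proof. by rewrite pnatr_eq0 -lt0n. Qed.
Let pR0 : p%:R != 0 :> R. Proof. by rewrite pnatr_eq0 -lt0n. Qed.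
Let w10 : w - 1 != 0. Proof. by rewrite subr_eq0. Qed.

Let M n := p%:R ^+ n * \sum_(0 <= k < p) b n k * w ^+ k.

Let eE r : w * (\sum_(s < r.+1) 'C(r, s)%:R * e s) = e r + (r == 0)%:R.
Proof.
have y0 : y != 0 by rewrite invr_eq0.
apply: (mulfI y0); rewrite mulrA.
have -> : y * w = y + 1 by rewrite /y; field.
have := congr1 (horner^~ y) (geom_poly_binomial F r).
rewrite !hornerE hornerMn hornerC -/(e r).
by rewrite horner_sum => <-; congr (_ * _); apply: eq_bigr => s _;
   rewrite hornerMn mulr_natl.
Qed.

Let bS n k : b n k.+1 = \sum_(l < n.+1) 'C(n, l)%:R * b l k * p%:R ^- (n - l).
Proof.
rewrite /b -natr1 mulrDl mul1r (bernoulli_add hB) rmorph_sum; apply: eq_bigr => l _.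
by rewrite !rmorphM/= rmorph_nat rmorphXn/= fmorphV rmorph_nat exprVn.
Qed.

Let bp n : b n p = b n 0 + (n == 1)%:R.
Proof.
have := bernoulli_diff hB n 0; rewrite add0r /b divff// mul0r => /eqP.
rewrite subr_eq addrC => /eqP ->; rewrite rmorphD; congr (_ + _).
case: n => [|[|n]]; rewrite ?mul0r ?rmorph0// ?mul1r ?rmorph1//=.
by rewrite exprS mul0r mulr0 rmorph0.
Qed.

(** The Fourier transform is unchanged, up to the jump of B_n between 0 and 1,
    by the shift from k to k + 1; the addition formula expresses the shifted
    values by Bernoulli polynomials of lower degree. *)
Let M_shift n : w * (\sum_(l < n.+1) 'C(n, l)%:R * M l) = M n + p%:R * (n == 1)%:R.
Proof.
have pM : p%:R * (n == 1)%:R = p%:R ^+ n * (n == 1)%:R :> F.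
  by case: eqP => [->|]; rewrite ?expr1// !mulr0.
transitivity (p%:R ^+ n * \sum_(0 <= k < p) b n k.+1 * w ^+ k.+1).
  under [in RHS]eq_bigr do rewrite bS mulr_suml.
  rewrite exchange_big/= !mulr_sumr; apply: eq_bigr => l _.
  rewrite /M !mulr_sumr; apply: eq_bigr => k _.
  have ln : (l <= n)%N by rewrite -ltnS.
  have -> : p%:R ^+ n = p%:R ^+ l * p%:R ^+ (n - l) :> F by rewrite -exprD subnKC.
  rewrite exprS; field.
  by rewrite expf_neq0.
rewrite -(big_add1 _ _ 0 p.+1 predT (fun k => b n k * w ^+ k)).
rewrite big_nat_recr//= wp mulr1 bp /M [\sum_(0 <= k < p) _]big_ltn// expr0 mulr1.
by rewrite pM; ring.
Qed.

(** Both sides satisfy the recursion that expresses F(t) (w e^t - 1) = pt for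
    their generating function F; as w <> 1, it determines them. *)
Lemma bernoulli_dft r :
  p%:R ^+ r.+1 * \sum_(0 <= k < p) phi (B r.+1).[k%:R / p%:R] * w ^+ k =
  r.+1%:R * p%:R * (geom_poly F r).[(w - 1)^-1].
Proof.
rewrite -/(M r.+1) -/(e r); have [m] := ubnP r; elim: m r => // m IH r rm.
have M0 : M 0 = 0.
  have := M_shift 0; rewrite big_ord1 bin0 mul1r mulr0 addr0 => /eqP.
  by rewrite -subr_eq0 -{2}[M 0]mul1r -mulrBl mulf_eq0 (negbTE w10) => /eqP.
apply: (mulfI w10); have := M_shift r.+1.
rewrite big_ord_recr/= binn mul1r big_ord_recl/= M0 mulr0 add0r.
have -> : \sum_(i < r) 'C(r.+1, bump 0 i)%:R * M (bump 0 i) =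
   r.+1%:R * p%:R * \sum_(s < r) 'C(r, s)%:R * e s.
  rewrite mulr_sumr; apply: eq_bigr => s _; rewrite /bump/= add1n IH; last first.
    by have := ltn_ord s; lia.
  have := mul_bin_diag r.+1 s.
  have -> : r.+1%:R * p%:R * ('C(r, s)%:R * e s) = (r.+1 * 'C(r, s))%N%:R * (p%:R * e s).
    by rewrite natrM; ring.
  by move=> ->; rewrite natrM; ring.
have := eE r; rewrite big_ord_recr/= binn mul1r.
set S := \sum_(_ < _) _ => E1 E2.
have E3 : w * S = e r + (r == 0)%:R - w * e r by rewrite -E1; ring.
have E4 : (w - 1) * M r.+1 = p%:R * (r == 0)%:R - r.+1%:R * p%:R * (w * S).
  have -> : (r == 0) = (r.+1 == 1) by [].
  by apply/eqP; rewrite -subr_eq0; move/eqP: E2; rewrite -subr_eq0 => /eqP <-; apply/eqP; ring.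
by rewrite E4 E3; case: (r =P 0) => [->|_] /=; ring.
Qed.

End BernoulliDFT.

(** * Roots of unity of prime order *)

Section PrimeRootsOfUnity.
Variable p : nat.
Hypothesis p_pr : prime p.

Lemma prime_primitive_root (F : fieldType) (z : F) :
  z ^+ p = 1 -> z != 1 -> p.-primitive_root z.
Proof.
move=> zp z1; have [k kz] := prim_order_exists (prime_gt0 p_pr) zp.
move/primeP: p_pr => [_ /[apply]] /orP[/eqP k1|/eqP<-//].
by move: z1; rewrite -[z]expr1 -k1 (prim_expr_order kz) eqxx.
Qed.

Lemma primitive_root_exp (F : fieldType) (z : F) k :
  p.-primitive_root z -> ~~ (p %| k)%N -> p.-primitive_root (z ^+ k).
Proof.
move=> zp pk; apply: prime_primitive_root; last by rewrite -(prim_order_dvd zp).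
by rewrite exprAC (prim_expr_order zp) expr1n.
Qed.

Definition geom_sum (A : nzRingType) : {poly A} := \poly_(i < p) 1.

Lemma geom_sumE (A : nzRingType) : geom_sum A = \sum_(i < p) 'X^i.
Proof. by rewrite /geom_sum poly_def; apply: eq_bigr => i _; rewrite scale1r. Qed.

Lemma size_geom_sum (A : nzRingType) : size (geom_sum A) = p.
Proof.
have := prime_gt0 p_pr; rewrite /geom_sum; case: (p) => // n _.
by rewrite size_poly_eq// oner_eq0.
Qed.

Lemma geom_sum_monic (A : nzRingType) : geom_sum A \is monic.
Proof.
rewrite monicE lead_coefE size_geom_sum coef_poly.
by have := prime_gt0 p_pr; case: (p) => // n _ /=; rewrite ltnSn.
Qed.

Lemma map_geom_sum (A A' : nzRingType) (f : {rmorphism A -> A'}) :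
  map_poly f (geom_sum A) = geom_sum A'.
Proof.
apply/polyP => i; rewrite coef_map !coef_poly.
by case: (i < p)%N; rewrite /= ?rmorph1 ?rmorph0.
Qed.

Lemma geom_sum_Xsub1 (A : comNzRingType) : ('X - 1) * geom_sum A = 'X^p - 1.
Proof. by rewrite geom_sumE -subrX1. Qed.

Lemma horner_geom_sum (F : fieldType) (z : F) :
  p.-primitive_root z -> (geom_sum F).[z] = 0.
Proof.
move=> zp; have := congr1 (horner^~ z) (geom_sum_Xsub1 F).
rewrite !hornerE (prim_expr_order zp) subrr => /eqP.
rewrite mulf_eq0 subr_eq0 => /orP[/eqP z1|/eqP//].
have := prim_order_dvd zp 1; rewrite expr1 z1 eqxx dvdn1 => /eqP p1.
by move: p_pr; rewrite p1.
Qed.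

Lemma horner_geom_sum1 (A : nzRingType) : (geom_sum A).[1] = p%:R.
Proof.
rewrite /geom_sum horner_poly; under eq_bigr do rewrite expr1n mulr1.
by rewrite sumr_const card_ord.
Qed.

Lemma prod_1sub_primitive_root (F : fieldType) (z : F) :
  p.-primitive_root z -> \prod_(1 <= k < p) (1 - z ^+ k) = p%:R.
Proof.
move=> zp; have := factor_Xn_sub_1 zp.
rewrite big_ltn ?prime_gt0// expr0 -geom_sum_Xsub1 polyC1.
move/(mulfI (negbT (polyXsubC_eq0 1))) => /(congr1 (horner^~ 1)).
rewrite horner_geom_sum1 => <-; rewrite horner_prod.
by apply: eq_bigr => k _; rewrite !hornerE.
Qed.

(** Irreducibility of the p-th cyclotomic polynomial over the rationals,
    for a root z in an arbitrary number field. The gcd with f has a root among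
    the algebraic numbers, where the minimal polynomial of a primitive root
    of unity is known. *)
Lemma geom_sum_rat_dvd (F : numFieldType) (z : F) (f : {poly rat}) :
  p.-primitive_root z -> (map_poly ratr f).[z] = 0 -> geom_sum rat %| f.
Proof.
move=> zp fz.
pose d := gcdp f (geom_sum rat).
have dz : root (map_poly ratr d) z.
  by rewrite /d gcdp_map root_gcd /root fz map_geom_sum horner_geom_sum ?eqxx.
have d0 : d != 0.
  by rewrite gcdp_eq0 negb_and (monic_neq0 (geom_sum_monic _)) orbT.
have : size (map_poly (ratr : rat -> algC) d) != 1.
  rewrite size_map_poly; apply/negP => /size_poly1P [c c0 dc].
  by move: dz; rewrite dc map_polyC /root hornerC fmorph_eq0 (negbTE c0).
move/closed_rootP => [x dx].
have /dvdpP [g Eg] : d %| geom_sum rat by exact: dvdp_gcdr.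
have x0 : (geom_sum algC).[x] = 0.
  rewrite -(map_geom_sum (ratr : {rmorphism rat -> algC})) Eg rmorphM hornerM.
  by rewrite (eqP dx) mulr0.
have xprim : p.-primitive_root x.
  apply: prime_primitive_root.
    have := congr1 (horner^~ x) (geom_sum_Xsub1 algC).
    by rewrite !hornerE x0 mulr0 => /esym/eqP; rewrite subr_eq0 => /eqP.
  apply/eqP => x1; move: x0; rewrite x1 horner_geom_sum1 => /eqP.
  by rewrite pnatr_eq0 => /eqP p0; move: p_pr; rewrite p0.
have [q [qx _ qdvd]] := minCpolyP x.
have sq : size q = p.
  rewrite -(size_map_poly (ratr : {rmorphism rat -> algC})) -qx.
  rewrite (minCpoly_cyclotomic xprim) size_cyclotomic totient_prime//.
  by rewrite prednK ?prime_gt0.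
have qd : q %| d by rewrite -qdvd.
apply: dvdp_trans (dvdp_gcdl f (geom_sum rat)).
have : size q == size (geom_sum rat) by rewrite sq size_geom_sum.
rewrite (dvdp_size_eqp (dvdp_trans qd (dvdp_gcdr _ _))) => /eqp_dvdl <-.
exact: qd.
Qed.

(** The remainder of the division by a monic integer polynomial is an
    integer polynomial, and it vanishes by rational divisibility. *)
Lemma geom_sum_int_dvd (F : numFieldType) (z : F) (f : {poly int}) :
  p.-primitive_root z -> (map_poly intr f).[z] = 0 ->
  exists g, f = g * geom_sum int.
Proof.
move=> zp fz; pose g := Pdiv.Ring.rdivp f (geom_sum int).
pose h := Pdiv.Ring.rmodp f (geom_sum int).
have fE : f = g * geom_sum int + h by exact: Pdiv.RingMonic.rdivp_eq (geom_sum_monic _) _.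
have hsz : (size h < p)%N.
  rewrite -[X in (_ < X)%N](size_geom_sum int) Pdiv.Ring.ltn_rmodpN0//.
  by rewrite monic_neq0// geom_sum_monic.
exists g; rewrite {1}fE; suff -> : h = 0 by rewrite addr0.
have inj := @intr_inj rat.
apply: (map_inj_poly inj (rmorph0 _)); rewrite rmorph0; apply/eqP.
apply: contraTT hsz => h0; rewrite -leqNgt.
rewrite -(size_map_inj_poly inj (rmorph0 _) h) -[X in (X <= _)%N](size_geom_sum rat).
apply: dvdp_leq => //; apply: (geom_sum_rat_dvd zp).
rewrite -map_poly_comp.
rewrite (eq_map_poly (g := intr)); last by move=> a; exact: ratr_int.
have -> : h = f - g * geom_sum int by rewrite {1}fE addrAC subrr add0r.
rewrite rmorphB rmorphM/= !hornerE fz map_geom_sum horner_geom_sum//.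
by rewrite mulr0 subrr.
Qed.

End PrimeRootsOfUnity.

(** * Gauss sums and the Kronecker product *)

Section GaussSum.
Variable p : nat.
Hypotheses (p_pr : prime p) (p_gt2 : (2 < p)%N).
Let m := p./2.

Let pE : p = m.*2.+1 := odd_prime_half p_pr p_gt2.

Let m_gt0 : (0 < m)%N.
Proof. by have := p_gt2; rewrite pE; case: (m). Qed.

Definition gauss_poly : {poly int} := \poly_(j < p) legendre j p.

(** Kronecker's product: at w = e^(i a) with w^p = 1 the k-th factor
    is 2 i sin(k a). *)
Definition sine_poly : {poly int} := \prod_(1 <= k < m.+1) ('X^k - 'X^(p - k)).

Lemma horner_gauss_poly (A : comNzRingType) (v : A) :
  (map_poly intr gauss_poly).[v] = \sum_(x : 'F_p) (legendre (x : nat) p)%:~R * v ^+ x.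
Proof.
rewrite -(big_Fp p_pr (fun j => (legendre j p)%:~R * v ^+ j)) big_mkord.
rewrite (@horner_coef_wide _ p); last first.
  by apply: leq_trans (size_poly _ _) _; exact: size_poly.
by apply: eq_bigr => i _; rewrite coef_map coef_poly ltn_ord.
Qed.

Lemma horner_sine_poly (A : comNzRingType) (v : A) :
  (map_poly intr sine_poly).[v] = \prod_(1 <= k < m.+1) (v ^+ k - v ^+ (p - k)).
Proof.
rewrite rmorph_prod horner_prod; apply: eq_bigr => k _.
by rewrite rmorphB /= !map_polyXn !hornerE.
Qed.

Lemma gauss_scale (F : numFieldType) (z : F) (a : nat) :
  p.-primitive_root z -> ~~ (p %| a)%N ->
  (map_poly intr gauss_poly).[z ^+ a] = (legendre a p)%:~R * (map_poly intr gauss_poly).[z].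
Proof.
move=> zp pa; rewrite !horner_gauss_poly.
rewrite -(sum_legendre_scale p_pr p_gt2 (F := fun k => z ^+ k) pa).
  by apply: eq_bigr => x _; rewrite exprM.
by move=> k; rewrite prim_expr_mod.
Qed.

(** Write G^2 as the sum over x of z^x times chi(x) G, and chi(x) G as the Gauss
    sum of z^x. Exchanging the sums, only the term y = -1 survives. *)
Lemma gauss_sqr (F : numFieldType) (z : F) : p.-primitive_root z ->
  (map_poly intr gauss_poly).[z] ^+ 2 = (legendre (-1) p)%:~R * p%:R.
Proof.
move=> zp; set G := _.[z].
have GE : G = \sum_(x : 'F_p) (legendre (x : nat) p)%:~R * z ^+ x by exact: horner_gauss_poly.
have gs (k : nat) : \sum_(x : 'F_p) (z ^+ k) ^+ x = (p %| k)%:R * p%:R.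
  rewrite -(big_Fp p_pr (fun j => (z ^+ k) ^+ j)) big_mkord.
  case: (boolP (p %| k)%N) => pk.
    have -> : z ^+ k = 1 by apply/eqP; rewrite -(prim_order_dvd zp).
    under eq_bigr do rewrite expr1n.
    by rewrite sumr_const card_ord mul1r.
  have := horner_geom_sum p_pr (primitive_root_exp p_pr zp pk).
  rewrite /geom_sum horner_poly mul0r => E; rewrite -[RHS]E.
  by apply: eq_bigr => i _; rewrite mul1r.
rewrite expr2 {1}GE mulr_suml.
transitivity (\sum_(x : 'F_p) \sum_(y : 'F_p)
    (legendre (y : nat) p)%:~R * z ^+ (1 + y) ^+ x).
  apply: eq_bigr => x _.
  have [->|x0] := eqVneq x 0.
    rewrite legendre0 !mul0r.
    under eq_bigr do rewrite expr0 mulr1.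
    by rewrite -(rmorph_sum (intr : int -> F)) sum_legendre0.
  have px : ~~ (p %| x)%N by rewrite -(natr_Fp_eq0 p_pr) natr_Zp.
  rewrite mulrAC -gauss_scale// horner_gauss_poly mulr_suml; apply: eq_bigr => y _.
  by rewrite -mulrA -!exprM -exprD mulnC addnC mulnDl mul1n.
rewrite exchange_big/=.
under eq_bigr do rewrite -mulr_sumr gs mulrA.
rewrite -mulr_suml; congr (_ * _).
have dvdE (x : 'F_p) : (p %| 1 + x)%N = (x == -1).
  by rewrite -(natr_Fp_eq0 p_pr) natrD natr_Zp addrC addr_eq0.
rewrite (eq_bigr (fun x : 'F_p => (legendre (x : nat) p)%:~R * (x == -1)%:R)); last first.
  by move=> x _; rewrite dvdE.
rewrite (bigD1 (-1 : 'F_p) isT) /= [X in _ + X]big1 => [|y yN1]; last first.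
  by rewrite (negbTE yN1) mulr0.
rewrite eqxx mulr1 addr0.
congr (_%:~R); apply: (legendre_mod p_pr p_gt2).
by rewrite -pmulrn [LHS](natr_Zp (-1 : 'F_p)) rmorphN1.
Qed.

(** The product over all 0 < k < p of z^k - z^(p-k) is (-1)^m times the square,
    since k and p - k give opposite factors; it is also the product of the
    1 - z^(2k), which is p. *)
Lemma sine_sqr (F : numFieldType) (z : F) : p.-primitive_root z ->
  (map_poly intr sine_poly).[z] ^+ 2 = (-1) ^+ m * p%:R.
Proof.
move=> zp; rewrite horner_sine_poly; set P := \prod_(_ <= _ < _) _.
pose a k := z ^+ k - z ^+ (p - k).
have Hz : \prod_(1 <= k < p) a k = p%:R.
  transitivity ((\prod_(1 <= k < p) z ^+ k) * \prod_(1 <= k < p) (1 - (z ^+ 2) ^+ (p - k))).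
    rewrite -big_split /= !big_nat; apply: eq_bigr => k /andP[k1 kp].
    rewrite /a mulrBr mulr1 -exprM -exprD; congr (_ - _).
    rewrite -(prim_expr_mod zp (k + _)); have -> : (k + 2 * (p - k) = p + (p - k))%N by lia.
    by rewrite modnDl (prim_expr_mod zp).
  (* The exponents add up to p m because p is odd. *)
  have -> : \prod_(1 <= k < p) z ^+ k = 1.
    rewrite -(big_morph _ (exprD z) (expr0 z)).
    have -> : (\sum_(1 <= k < p) k = p * m)%N.
      have := bin2_sum p; rewrite big_ltn ?prime_gt0// add0n => ->.
      by rewrite bin2 {2}pE /= -mul2n mulnCA mul2n doubleK.
    by rewrite exprM (prim_expr_order zp) expr1n.
  have zp2 : p.-primitive_root (z ^+ 2).
    by apply: primitive_root_exp => //; apply/negP => /dvdn_leq; have := p_gt2; lia.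
  rewrite mul1r big_nat_rev/= -(prod_1sub_primitive_root p_pr zp2) big_nat [RHS]big_nat.
  apply: eq_bigr => k /andP[k1 kp].
  by have -> : (p - (1 + p - k.+1) = k)%N by lia.
have: \prod_(1 <= k < p) a k = P * ((-1) ^+ m * P).
  rewrite (big_cat_nat (n := m.+1))//=; last by have := pE; lia.
  congr (_ * _).
  transitivity (\prod_(1 <= k < m.+1) (- a k)).
    rewrite (big_addn 1 p m) big_nat_rev.
    have -> : (p - m = m.+1)%N by have := pE; lia.
    rewrite [LHS]big_nat [RHS]big_nat; apply: eq_bigr => k /andP[k1 km].
    have -> : (1 + m.+1 - k.+1 + m = p - k)%N by have := pE; lia.
    by rewrite /a opprB subKn//; have := pE; lia.
  under eq_bigr do rewrite -mulN1r.
  by rewrite big_split /= prodr_const_nat subn1.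
rewrite Hz => E; rewrite expr2.
rewrite E; have := sqrr_sign F m; move: ((-1) ^+ m : F) => s s2.
by rewrite -[LHS]mul1r -s2; ring.
Qed.

(** The operator X d/dX. By Euler's criterion its m-th power maps
    1 + X + ... + X^(p-1) to the Gauss polynomial mod p. *)
Definition euler_op (A : nzRingType) (q : {poly A}) : {poly A} := 'X * q^`().

Lemma iter_euler_op_sum (A : comNzRingType) k n :
  iter k (@euler_op A) (\sum_(i < n) 'X^i) = \sum_(i < n) (i%:R ^+ k)%:P * 'X^i.
Proof.
elim: k => [|k IH]; first by apply: eq_bigr => i _; rewrite expr0 mul1r.
rewrite iterS IH /euler_op raddf_sum mulr_sumr; apply: eq_bigr => i _ /=.
rewrite derivM derivC mul0r add0r derivXn mulrCA exprSr rmorphM/= -mulrA; congr (_ * _).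
case: (nat_of_ord i) => [|j]; first by rewrite mulr0n mulr0 mul0r.
by rewrite mulrnAr -exprS polyC_natr mulr_natl.
Qed.

(** Each application lowers the order of vanishing at 1 by one and multiplies
    the leading coefficient by that order. *)
Lemma iter_euler_op_Xsub1 (A : comNzRingType) k n : (k <= n)%N ->
  exists v : {poly A}, iter k (@euler_op A) (('X - 1) ^+ n) = v * ('X - 1) ^+ (n - k)
    /\ v.[1] = (n ^_ k)%:R.
Proof.
elim: k => [|k IH] kn.
  by exists 1; rewrite mul1r subn0 hornerC ffactn0.
have [v [vE v1]] := IH (ltnW kn).
have -> : (n - k.+1 = (n - k).-1)%N by lia.
have nk : (0 < n - k)%N by rewrite subn_gt0.
exists ('X * (v^`() * ('X - 1) + (n - k)%:R * v)); split.
  rewrite iterS vE /euler_op derivM deriv_exp derivB derivX (derivC 1) subr0 mul1r.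
  by case: (n - k)%N nk => // l _ /=; rewrite exprS -mulr_natl; ring.
rewrite !hornerE hornerMn hornerC v1 ffactnSr natrM mulr_natr subrr mulr0 add0r.
by rewrite mulr_natl.
Qed.

Lemma geom_sum_Fp : geom_sum p 'F_p = ('X - 1) ^+ p.-1.
Proof.
have X1 : ('X - 1 : {poly 'F_p}) != 0 by rewrite -polyC1 polyXsubC_eq0.
apply: (mulfI X1); rewrite geom_sum_Xsub1 -exprS prednK ?prime_gt0//.
have pc : p \in [pchar {poly 'F_p}] by rewrite pchar_poly pchar_Fp.
by rewrite -!(pFrobenius_autE pc) pFrobenius_autB_comm ?pFrobenius_aut1//; exact: mulrC.
Qed.

(** The value at 1 is (p-1)(p-2)...(p-m). *)
Lemma gauss_poly_Fp : exists v : {poly 'F_p},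
  map_poly intr gauss_poly = v * ('X - 1) ^+ m /\ v.[1] = (-1) ^+ m * (m`!)%:R.
Proof.
have [|v [vE v1]] := @iter_euler_op_Xsub1 'F_p m p.-1; first by have := pE; lia.
exists v; split.
  have -> : m = (p.-1 - m)%N by have := pE; lia.
  rewrite -vE -geom_sum_Fp geom_sumE iter_euler_op_sum.
  apply/polyP => i; rewrite coef_map coef_poly coef_sum.
  case: ltnP => ip.
    rewrite (bigD1 (Ordinal ip))//= big1 ?addr0; last first.
      move=> j ji; rewrite coefCM coefXn; case: eqP => [ij|]; last by rewrite mulr0.
      by case/eqP: ji; apply: val_inj.
    by rewrite coefCM coefXn eqxx mulr1 legendre_Fp// -pmulrn.
  rewrite /= mulr0z big1// => j _; rewrite coefCM coefXn gtn_eqF ?mulr0//.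
  exact: leq_trans (ltn_ord j) ip.
rewrite v1 ffact_prod natr_prod.
rewrite fact_prod natr_prod big_add1/= big_mkord -[X in (-1) ^+ X]card_ord -prodr_const.
rewrite -big_split/=; apply: eq_bigr => i _.
have ip : (i < m)%N := ltn_ord i.
apply/eqP; rewrite mulN1r -addr_eq0 -natrD natr_Fp_eq0//.
by have -> : (p.-1 - i + i.+1 = p)%N by have := pE; lia.
Qed.

Lemma prime_ndvd_fact n : (n < p)%N -> ~~ (p %| n`!)%N.
Proof.
elim: n => [_|n IH np]; first by rewrite fact0 dvdn1; apply/eqP => p1; move: p_gt2; rewrite p1.
rewrite factS Euclid_dvdM// negb_or IH ?andbT; last exact: ltnW.
by apply/negP => /dvdn_leq; lia.
Qed.

(** The k-th factor is -(X - 1) X^k (1 + ... + X^(p-2k-1)), and -(p - 2k) is 2k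
    mod p. *)
Lemma sine_poly_Fp : exists u : {poly 'F_p},
  map_poly intr sine_poly = u * ('X - 1) ^+ m /\ u.[1] = 2 ^+ m * (m`!)%:R.
Proof.
have prod_const (A : pzRingType) (x : A) : x ^+ m = \prod_(1 <= k < m.+1) x.
  by rewrite prodr_const_nat subn1.
exists (\prod_(1 <= k < m.+1) (- 'X^k * \sum_(i < p - k.*2) 'X^i)); split.
  rewrite prod_const -big_split/= rmorph_prod !big_nat; apply: eq_bigr => k /andP[k1 km].
  rewrite rmorphB /= !map_polyXn -mulrA [_ * ('X - 1)]mulrC -subrX1.
  rewrite mulNr mulrBr mulr1 opprB -exprD.
  by have -> : (k + (p - k.*2) = p - k)%N by have := pE; lia.
rewrite horner_prod fact_prod natr_prod prod_const -big_split/= !big_nat.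
apply: eq_bigr => k /andP[k1 km].
rewrite !hornerE horner_sum expr1n.
under eq_bigr do rewrite hornerXn expr1n.
rewrite sumr_const card_ord mulN1r; apply/eqP; rewrite eq_sym -subr_eq0 opprK.
rewrite -natrM -natrD natr_Fp_eq0//.
by have -> : (2 * k + (p - k.*2) = p)%N by have := pE; lia.
Qed.

(** The squares agree, so the two sides differ by a sign e. Modulo p the
    difference of the two polynomials is divisible by (X - 1)^(2m); comparing
    the coefficients of (X - 1)^m gives e 2^m = (-1)^m, and 2^m is the Legendre
    symbol of 2. *)
Lemma gauss_sine (F : numFieldType) (z : F) : p.-primitive_root z ->
  (map_poly intr gauss_poly).[z] =
  ((-1) ^+ m * legendre 2 p)%:~R * (map_poly intr sine_poly).[z].
Proof.
move=> zp.
have [e [eS Ge]] : exists e : int, e \in [:: -1; 0; 1] /\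
    (map_poly intr gauss_poly).[z] = e%:~R * (map_poly intr sine_poly).[z].
  have : (map_poly intr gauss_poly).[z] ^+ 2 == (map_poly intr sine_poly).[z] ^+ 2.
    rewrite gauss_sqr// sine_sqr// legendreN1//.
    by rewrite rmorphXn/= rmorphN1.
  rewrite eqf_sqr => /orP[]/eqP ->; first by exists 1; rewrite mul1r.
  by exists (-1); rewrite mulN1r.
suff eE : e = (-1) ^+ m * legendre 2 p by rewrite Ge eE.
have [|g gE] := geom_sum_int_dvd p_pr (f := gauss_poly - e%:P * sine_poly) zp.
  by rewrite rmorphB rmorphM/= map_polyC/= !hornerE Ge subrr.
have [v [vE v1]] := gauss_poly_Fp; have [u [uE u1]] := sine_poly_Fp.
have : v.[1] = e%:~R * u.[1].
  have := congr1 (map_poly (intr : int -> 'F_p)) gE.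
  rewrite rmorphB !rmorphM/= map_polyC/= map_geom_sum geom_sum_Fp vE uE.
  have -> : p.-1 = (m + m)%N by have := pE; lia.
  rewrite exprD !mulrA -mulrBl.
  have X1 : ('X - 1 : {poly 'F_p}) ^+ m != 0.
    by rewrite expf_neq0// -polyC1 polyXsubC_eq0.
  move/(mulIf X1)/(congr1 (horner^~ 1)).
  rewrite !hornerE subrr expr0n (gtn_eqF m_gt0) mulr0 => /eqP.
  by rewrite subr_eq0 => /eqP.
rewrite v1 u1 mulrA => /mulIf E.
have {}E : (-1) ^+ m = (e * legendre 2 p)%:~R :> 'F_p.
  rewrite rmorphM/= legendre_Fp//; apply: E.
  by rewrite natr_Fp_eq0// prime_ndvd_fact//; have := pE; lia.
have {}E : (-1) ^+ m = e * legendre 2 p.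
  apply: (sign_Fp_inj p_pr p_gt2); last by rewrite -E rmorphXn/= rmorphN1.
    by rewrite -signr_odd; case: (odd m).
  have := legendre_values p 2; move: eS.
  by rewrite !inE => /or3P[]/eqP-> /or3P[]/eqP->.
rewrite E -mulrA legendre_sqr ?mulr1//.
by apply/negP => /dvdn_leq; have := p_gt2; lia.
Qed.

End GaussSum.

(** * The value of the Gauss sum *)

Section ComplexExponential.
Variable R : realType.
Implicit Types x y : R.

Definition cis x : R[i] := Complex (cos x) (sin x).

Lemma cisD x y : cis (x + y) = cis x * cis y.
Proof. by apply/eqP; rewrite eq_complex /= cosD sinD eqxx/= addrC eqxx. Qed.

Lemma cisMn x n : cis (x *+ n) = cis x ^+ n.
Proof.
elim: n => [|n IH]; first by rewrite /cis mulr0n cos0 sin0 expr0.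
by rewrite mulrS cisD IH exprS.
Qed.

Lemma cispi : cis pi = -1.
Proof. by rewrite /cis cospi sinpi; apply/eqP; rewrite eq_complex /= oppr0 !eqxx. Qed.

(** The point e^(2ix) - 1 equals 2i sin(x) e^(ix). *)
Lemma inv_cis2_sub1 x : sin x != 0 ->
  (cis (x *+ 2) - 1)^-1 = - 2^-1 - 'i%C / 2 * (cot x)%:C%C.
Proof.
move=> sx; have E : (cis (x *+ 2) - 1) * (- 2^-1 - 'i%C / 2 * (cot x)%:C%C) = 1.
  have -> : (2^-1 : R[i]) = (2^-1)%:C%C by rewrite fmorphV rmorph_nat.
  have c2 : cos (x *+ 2) = 1 - 2 * sin x ^+ 2.
    by have := cos2Dsin2 x; rewrite mulr2n cosD; lra.
  have s2 : sin (x *+ 2) = 2 * sin x * cos x by rewrite mulr2n sinD; ring.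
  rewrite /cis c2 s2 /cot; apply/eqP; rewrite eq_complex /=.
  apply/andP; split; apply/eqP; last by field.
  by rewrite -[RHS](cos2Dsin2 x); field.
have n0 : cis (x *+ 2) - 1 != 0.
  by apply/eqP => z0; move/eqP: E; rewrite z0 mul0r eq_sym oner_eq0.
by apply: (mulfI n0); rewrite E mulfV.
Qed.

End ComplexExponential.

Section GaussSumValue.
Variables (R : realType) (p : nat).
Hypotheses (p_pr : prime p) (p_gt2 : (2 < p)%N).
Let m := p./2.
Let C := R[i].

Let pE : p = m.*2.+1 := odd_prime_half p_pr p_gt2.

Definition zeta : C := cis (2 * pi / p%:R).

Let theta : R := pi / p%:R.
(** The square root of zeta which is again a p-th root of unity. *)
Let omega : C := - cis theta.

Let p0 : p%:R != 0 :> R. Proof. by rewrite pnatr_eq0 -lt0n prime_gt0. Qed.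

Lemma sin_pi_frac_gt0 (j : nat) : (0 < j < p)%N -> 0 < sin (pi * j%:R / p%:R : R).
Proof.
move=> /andP[j0 jp]; have p_gt0 := prime_gt0 p_pr; apply: sin_gt0_pi.
rewrite divr_gt0 ?mulr_gt0 ?pi_gt0 ?ltr0n//=.
by rewrite ltr_pdivrMr ?ltr0n// ltr_pM2l ?pi_gt0// ltr_nat.
Qed.

Let thetaMn k : theta *+ k = pi * k%:R / p%:R.
Proof. by rewrite -[LHS]mulr_natr /theta mulrAC. Qed.

Let omega_prim : p.-primitive_root omega.
Proof.
apply: (prime_primitive_root p_pr).
  rewrite /omega exprNn -cisMn thetaMn mulfK// cispi.
  by rewrite -signr_odd pE /= odd_double expr1 mulrNN mulr1.
have := @sin_pi_frac_gt0 1 (prime_gt1 p_pr); rewrite mulr1 => s0.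
by rewrite eqr_oppLR eq_complex /= oppr0 negb_and (gt_eqF s0) orbT.
Qed.

Let zetaE : zeta = omega ^+ 2.
Proof.
rewrite /omega sqrrN -cisMn. rewrite thetaMn /zeta. rewrite [pi * _]mulrC. by []. Qed.

Lemma zeta_primitive : p.-primitive_root zeta.
Proof.
rewrite zetaE; apply: primitive_root_exp => //.
by apply/negP => /dvdn_leq; have := p_gt2; lia.
Qed.

Let omega_sub k : (0 < k < p)%N ->
  omega ^+ k - omega ^+ (p - k) = (-1) ^+ k * 'i%C * (2 * sin (pi * k%:R / p%:R))%:C%C.
Proof.
move=> /andP[k0 kp]; rewrite /omega !(exprNn (cis theta)) -!cisMn !thetaMn.
have -> : (-1) ^+ (p - k) = - (-1) ^+ k :> C.
  rewrite -signr_odd oddB; last exact: ltnW.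
  by rewrite {1}pE /= odd_double -[in RHS]signr_odd; case: (odd k); rewrite ?opprK.
have -> : pi * (p - k)%:R / p%:R = pi - pi * k%:R / p%:R :> R.
  by rewrite natrB; [field|exact: ltnW].
rewrite mulNr opprK -mulrDr -[RHS]mulrA; congr (_ * _).
rewrite /cis cosB sinB cospi sinpi; apply/eqP; rewrite eq_complex /=.
by apply/andP; split; apply/eqP; ring.
Qed.

Let gauss_unit (n : nat) : C := if odd n then 'i%C else 1.

(** Each step n |-> n + 1 contributes (-1)^n i, so that two steps
    contribute 1. *)
Let sign_prod n (f : nat -> C) :
  (-1) ^+ n * \prod_(1 <= k < n.+1) ((-1) ^+ k * 'i%C * f k) =
  gauss_unit n * \prod_(1 <= k < n.+1) f k.
Proof.
elim: n => [|n IH]; first by rewrite !big_geq// expr0.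
rewrite !(big_nat_recr n.+1)//= !exprS.
set P := \prod_(_ <= _ < _) _ in IH *.
have -> : -1 * (-1) ^+ n * (P * (-1 * (-1) ^+ n * 'i%C * f n.+1)) =
  ((-1) ^+ n * 'i%C) * ((-1) ^+ n * P) * f n.+1 by ring.
rewrite IH /gauss_unit /= -[in (-1) ^+ n]signr_odd; set Q := \prod_(_ <= _ < _) _.
case: (odd n) => /=; last by ring.
by transitivity (- ('i%C ^+ 2) * (Q * f n.+1)); [ring|rewrite sqr_i opprK].
Qed.

(** The Kronecker product is evaluated at omega rather than at zeta: there its
    sines have arguments pi k / p below pi / 2, so they are all positive. The
    symbol of 2 from [gauss_sine] cancels against the one from
    zeta = omega ^+ 2. *)
Lemma gauss_value : (map_poly intr (gauss_poly p)).[zeta] =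
  (if odd m then 'i%C else 1) * (Num.sqrt p%:R)%:C%C.
Proof.
have p2 : ~~ (p %| 2)%N by apply/negP => /dvdn_leq; have := p_gt2; lia.
pose s : R := \prod_(1 <= k < m.+1) (2 * sin (pi * k%:R / p%:R)).
have GE : (map_poly intr (gauss_poly p)).[zeta] = gauss_unit m * s%:C%C.
  rewrite zetaE gauss_scale// gauss_sine// -/m mulrA -rmorphM mulrCA legendre_sqr// mulr1.
  rewrite horner_sine_poly rmorphXn rmorphN1 /= -/m.
  rewrite rmorph_prod -sign_prod; congr (_ * _).
  rewrite !big_nat; apply: eq_bigr => k /andP[k0 km]; apply: omega_sub.
  by have := pE; lia.
rewrite GE; congr (_ * _%:C%C).
have s0 : 0 <= s.
  rewrite /s big_nat; apply: prodr_ge0 => k /andP[k0 km].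
  by rewrite mulr_ge0// ltW// sin_pi_frac_gt0//; have := pE; lia.
have : gauss_unit m ^+ 2 = (-1) ^+ m.
  rewrite -signr_odd /gauss_unit; case: (odd m); first by rewrite sqr_i.
  by rewrite expr1n.
move=> u2; have := gauss_sqr p_pr p_gt2 zeta_primitive.
rewrite GE exprMn u2 legendreN1// rmorphXn rmorphN1 /= -/m.
move/(mulfI _); rewrite signr_eq0 => /(_ isT).
rewrite -rmorphXn -(rmorph_nat (real_complex R)) => /complexI s2.
by rewrite -s2 sqrtr_sqr ger0_norm.
Qed.

End GaussSumValue.

(** * Derivatives of the cotangent *)

Section CotangentDerivatives.
Variable R : realType.
Implicit Types x : R.

(** The sign (-1)^r is split off from the r-th derivative of cot so that all
    coefficients are nonnegative. *)
Definition cot_poly r : {poly R} := iter_derivation (1 + 'X^2) r.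

Lemma is_derive_cot x : sin x != 0 -> is_derive x 1 (@cot R) (- (1 + cot x ^+ 2)).
Proof.
move=> sx; apply: trigger_derive; rewrite /cot /GRing.scale /=.
by field.
Qed.

Lemma derive1n_cot r x : sin x != 0 ->
  derive1n r (@cot R) x = (-1) ^+ r * (cot_poly r).[cot x].
Proof.
elim: r x => [|r IH] x sx; first by rewrite derive1n0 mul1r hornerX.
rewrite derive1nS derive1E.
(* The induction hypothesis holds in a neighbourhood, so it may be derived. *)
have nr : \near x, derive1n r (@cot R) x = (((-1) ^+ r)%:P * cot_poly r).[cot x].
  have : \forall y \near x, sin y != 0 by exact: (cvgr_neq0 _ (@continuous_sin R x) sx).
  by apply: filterS => y sy; rewrite IH// hornerM hornerC.
rewrite (near_eq_derive _ nr).
have dc := is_derive_cot sx.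
set q := ((-1) ^+ r)%:P * cot_poly r.
have dq : is_derive (cot x) 1 (horner q) (q^`()).[cot x].
  by apply: DeriveDef; [exact: derivable_horner|rewrite derivE derive1E].
have -> : 'D_1 (fun y => q.[cot y]) x = (q^`()).[cot x] * (- (1 + cot x ^+ 2)).
  exact: (@derive_val _ _ _ _ _ _ _ (is_derive1_comp dq dc)).
have h1 : (1 + 'X^2 : {poly R}).[cot x] = 1 + cot x ^+ 2 by rewrite !hornerE.
rewrite /q derivM derivC mul0r add0r /cot_poly iter_derivationS.
by rewrite hornerM hornerC hornerM h1 (exprS _ r); ring.
Qed.

Lemma cot_poly_opp r c : (0 < r)%N ->
  (cot_poly r).[- c] = (-1) ^+ r.+1 * (cot_poly r).[c].
Proof.
move=> r0; have n1 : (-1 : R) != 0 by rewrite oppr_eq0 oner_eq0.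
have h : (1 + 'X^2 : {poly R}) \Po (0%:P + (-1) *: 'X) = (-1 * -1) *: (1 + 'X^2).
  rewrite comp_polyD comp_Xn_poly -polyC1 comp_polyC add0r.
  by rewrite scaleN1r sqrrN mulN1r opprK scale1r.
have := iter_derivation_affine n1 h r0 => /(congr1 (horner^~ c)).
by rewrite horner_comp hornerZ hornerD hornerC add0r hornerZ hornerX mulN1r -exprS.
Qed.

Lemma cot_poly_coef_ge0 r i : 0 <= (cot_poly r)`_i.
Proof.
elim: r i => [|r IH] i; first by rewrite coefX ler0n.
rewrite /cot_poly iter_derivationS mulrDl mul1r coefD coefXnM addr_ge0//.
  by rewrite coef_deriv mulrn_wge0// IH.
by case: ifP => // _; rewrite coef_deriv mulrn_wge0// IH.
Qed.

Lemma ge0_coef_horner_mono (q : {poly R}) (a b : R) :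
  (forall i, 0 <= q`_i) -> 0 <= a -> a <= b -> 0 <= q.[a] <= q.[b].
Proof.
move=> q0 a0 ab; rewrite !horner_coef sumr_ge0/=; last first.
  by move=> i _; rewrite mulr_ge0// exprn_ge0.
apply: ler_sum => i _; rewrite ler_wpM2l// lerXn2r// nnegrE//.
exact: le_trans ab.
Qed.

End CotangentDerivatives.

(** * From roots of unity to cotangents, and an inequality for cosecants *)

(** With y = -1/2 - (i/2) c one has -(y + y^2) = (1 + c^2) / 4, so this is
    [iter_derivation_affine] with b = -i/2 and k = i/2. *)
Lemma geom_poly_cot (R : realType) r (c : R) : (0 < r)%N ->
  (geom_poly R[i] r).[- 2^-1 - 'i%C / 2 * c%:C%C] =
  - ('i%C / 2) * ('i%C / 2) ^+ r * ((cot_poly R r).[c])%:C%C.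
Proof.
move=> r0; set b : R[i] := - ('i%C / 2).
have i0 : 'i%C != 0 :> R[i] by rewrite eq_complex /= oner_eq0 andbF.
have b0 : b != 0 by rewrite oppr_eq0 mulf_neq0// invr_eq0 pnatr_eq0.
have b2 : b ^+ 2 = - (2^-1 * 2^-1).
  by rewrite sqrrN exprMn sqr_i mulN1r exprVn expr2 invfM.
have h : (- ('X + 'X^2) : {poly R[i]}) \Po ((- 2^-1)%:P + b *: 'X) =
    (b * ('i%C / 2)) *: (1 + 'X^2).
  rewrite raddfN /= comp_polyD comp_polyX comp_Xn_poly.
  have -> : b * ('i%C / 2) = 2^-1 * 2^-1 by rewrite -[RHS]opprK -b2 /b sqrrN mulNr expr2.
  rewrite sqrrD exprZn b2.
  have -> : (2^-1 * 2^-1) *: (1 + 'X^2) =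
      (2^-1 * 2^-1)%:P + (2^-1 * 2^-1) *: 'X^2 :> {poly R[i]}.
    by rewrite scalerDr alg_polyC.
  have two : (2^-1 : R[i]) *+ 2 = 1 by rewrite -[LHS]mulr_natl mulfV// pnatr_eq0.
  have -> : ((- 2^-1)%:P * (b *: 'X)) *+ 2 = - (b *: 'X) :> {poly R[i]}.
    by rewrite -mulrnAl -polyCMn mulNrn two polyCN polyC1 mulN1r.
  have -> : ((- 2^-1)%:P : {poly R[i]}) ^+ 2 = (2^-1 * 2^-1)%:P.
    by rewrite -polyC_exp sqrrN expr2.
  rewrite (scaleNr (2^-1 * 2^-1)).
  have h2 : (- 2^-1)%:P + (2^-1 * 2^-1)%:P = - (2^-1 * 2^-1)%:P :> {poly R[i]}.
    by rewrite -polyCD -polyCN; congr _%:P; field.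
  set X := b *: 'X; set Y := _ *: 'X^2; move: h2.
  set u := (- 2^-1)%:P; set v := (2^-1 * 2^-1)%:P => h2.
  have -> : - (u + X + (v - X - Y)) = - (u + v) + Y by ring.
  by rewrite h2 opprK.
have := iter_derivation_affine b0 h r0 => /(congr1 (horner^~ c%:C%C)).
rewrite horner_comp hornerZ hornerD hornerC hornerZ hornerX.
rewrite /b mulNr => ->; congr (_ * _).
have -> : (1 + 'X^2 : {poly R[i]}) = map_poly (real_complex R) (1 + 'X^2).
  by rewrite rmorphD rmorph1 /= map_polyXn.
by rewrite -map_iter_derivation horner_map.
Qed.

Lemma sum_symmetric (A : nmodType) (p : nat) (f : nat -> A) : odd p ->
  (forall j, (0 < j < p)%N -> f (p - j)%N = f j) ->
  \sum_(1 <= j < p) f j = (\sum_(1 <= j < p./2.+1) f j) *+ 2.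
Proof.
move=> po fs; have pE := odd_double_half p; rewrite po add1n in pE.
have [m0|m0] := posnP p./2; first by rewrite -pE m0 !big_geq// mul0rn.
rewrite (big_cat_nat (n := p./2.+1))//=; last by lia.
rewrite mulr2n; congr (_ + _).
rewrite (big_addn 1 p p./2) big_nat_rev.
have -> : (p - p./2 = p./2.+1)%N by lia.
rewrite [LHS]big_nat [RHS]big_nat; apply: eq_bigr => k /andP[k1 km].
have -> : (1 + p./2.+1 - k.+1 + p./2 = p - k)%N by lia.
by apply: fs; lia.
Qed.

Section CotangentInequality.
Variables (R : realType) (x : R) (m : nat).
Hypotheses (x0 : 0 < x) (m0 : (0 < m)%N) (mx : m%:R * x <= pi / 2).

Let jx j : (0 < j <= m)%N -> 0 < j%:R * x <= pi / 2.
Proof.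
move=> /andP[j0 jm]; rewrite mulr_gt0 ?ltr0n//=.
by apply: le_trans mx; rewrite ler_wpM2r ?ler_nat// ltW.
Qed.

Let pi2 : pi / 2 < pi :> R.
Proof. by have := pi_gt0 R; lra. Qed.

Let sin_pos j : (0 < j <= m)%N -> 0 < sin (j%:R * x).
Proof.
move=> /jx /andP[h1 h2]; apply: sin_gt0_pi; rewrite h1/=.
exact: le_lt_trans pi2.
Qed.

Let cot_pos j : (0 < j <= m)%N -> 0 <= cot (j%:R * x).
Proof.
move=> h; apply: divr_ge0; last by rewrite ltW// sin_pos.
move/jx: h => /andP[h1 h2]; apply: cos_ge0_pihalf; rewrite h2 andbT.
by apply: le_trans (ltW h1); rewrite oppr_le0 divr_ge0// pi_ge0.
Qed.

Let sin_le j : (0 < j < m)%N -> sin (j%:R * x) <= sin (j.+1%:R * x).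
Proof.
move=> /andP[j0 jm].
have /andP[a1 a2] : 0 < j%:R * x <= pi / 2 by apply: jx; rewrite j0 ltnW.
have /andP[b1 b2] : 0 < j.+1%:R * x <= pi / 2 by apply: jx.
have np : - (pi / 2) <= 0 :> R by rewrite oppr_le0 divr_ge0// pi_ge0.
apply/ltW; rewrite ltr_sin ?in_itv/=; last 2 first.
- by rewrite a2 andbT (le_trans np)// ltW.
- by rewrite b2 andbT (le_trans np)// ltW.
by rewrite ltr_pM2r// ltr_nat.
Qed.

Let cot_step j : (0 < j < m)%N ->
  cot (j%:R * x) - cot (j.+1%:R * x) = sin x / (sin (j%:R * x) * sin (j.+1%:R * x)).
Proof.
move=> /andP[j0 jm].
have s1 : sin (j%:R * x) != 0 by rewrite gt_eqF// sin_pos// j0 ltnW.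
have s2 : sin (j.+1%:R * x) != 0 by rewrite gt_eqF// sin_pos.
have -> : sin x = sin (j.+1%:R * x) * cos (j%:R * x) - cos (j.+1%:R * x) * sin (j%:R * x).
  by rewrite -sinB -mulrBl -natrB ?leqnSn// subSnn mul1r.
by rewrite /cot; field; rewrite s1 s2.
Qed.

Let sinx_gt0 : 0 < sin x.
Proof. by have := @sin_pos 1; rewrite mul1r; apply. Qed.

Lemma cot_decr j : (0 < j <= m)%N -> 0 <= cot (j%:R * x) <= cot x.
Proof.
move=> jm; rewrite cot_pos//=; elim: j jm => // j IH jm.
have [->|j0] := posnP j; first by rewrite mul1r.
apply: le_trans (IH _); last by rewrite j0 ltnW.
have jm' : (0 < j < m)%N by rewrite j0.
by rewrite -subr_ge0 cot_step// divr_ge0 ?mulr_ge0// ltW// ?sin_pos// j0 ltnW.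
Qed.

(** For sines increasing along x, 2x, ..., mx,
    1 / sin^2(jx) <= 1 / (sin((j-1)x) sin(jx)) = (cot((j-1)x) - cot(jx)) / sin x.
    The sum telescopes to at most cot x / sin x = cos x / sin^2 x. *)
Lemma sum_csc2_le : \sum_(2 <= j < m.+1) sin (j%:R * x) ^- 2 <= sin x ^- 2.
Proof.
have H n : (0 < n <= m)%N ->
    \sum_(2 <= j < n.+1) sin (j%:R * x) ^- 2 <= (cot x - cot (n%:R * x)) / sin x.
  elim: n => // n IH /andP[_ nm].
  have [->|n0] := posnP n; first by rewrite big_geq// mul1r subrr mul0r.
  have nm' : (0 < n < m)%N by rewrite n0.
  have nm2 : (0 < n <= m)%N by rewrite n0 ltnW.
  rewrite big_nat_recr//=.
  have -> : (cot x - cot (n.+1%:R * x)) / sin x = (cot x - cot (n%:R * x)) / sin x +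
     (cot (n%:R * x) - cot (n.+1%:R * x)) / sin x by ring.
  apply: lerD; first exact: IH.
  rewrite cot_step// mulrAC divff ?gt_eqF// div1r.
  rewrite lef_pV2 ?posrE ?exprn_gt0 ?mulr_gt0 ?sin_pos//.
  by rewrite expr2 ler_pM2r ?sin_pos// sin_le.
apply: le_trans (H m _) _; first by rewrite m0 /=.
apply: (@le_trans _ _ (cot x / sin x)).
  by rewrite ler_pM2r ?invr_gt0// gerBl cot_pos// m0 /=.
by rewrite /cot -mulrA -invfM -expr2 ler_piMl ?invr_ge0 ?exprn_ge0 ?cos_le1// ltW.
Qed.

End CotangentInequality.

(** * Integrality at p and away from p *)

Section LocalIntegrality.
Variables (R : realType) (p : nat).
Hypothesis p_pr : prime p.
Implicit Types x y : R.

(** The real numbers in the localization of the integers at p. *)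
Definition loc_int x := exists2 M : nat, coprime p M & M%:R * x \is a Num.int.

Lemma loc_int_int x : x \is a Num.int -> loc_int x.
Proof. by exists 1; rewrite ?coprimen1// mul1r. Qed.

Lemma loc_intD x y : loc_int x -> loc_int y -> loc_int (x + y).
Proof.
move=> [M pM Mx] [N pN Ny]; exists (M * N)%N; first by rewrite coprimeMr pM.
have -> : (M * N)%:R * (x + y) = N%:R * (M%:R * x) + M%:R * (N%:R * y).
  by rewrite natrM; ring.
by apply: rpredD; apply: rpredM; rewrite ?rpred_nat.
Qed.

Lemma loc_intM x y : loc_int x -> loc_int y -> loc_int (x * y).
Proof.
move=> [M pM Mx] [N pN Ny]; exists (M * N)%N; first by rewrite coprimeMr pM.
have -> : (M * N)%:R * (x * y) = (M%:R * x) * (N%:R * y) by rewrite natrM; ring.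
exact: rpredM.
Qed.

Lemma loc_int_sum (I : Type) (s : seq I) (P : pred I) (f : I -> R) :
  (forall i, P i -> loc_int (f i)) -> loc_int (\sum_(i <- s | P i) f i).
Proof.
by move=> H; apply: big_ind => //; [exact/loc_int_int/rpred0|exact: loc_intD].
Qed.

(** If p^v exactly divides e + 1 then v <= e. *)
Lemma loc_int_expr_div e : loc_int (p%:R ^+ e / e.+1%:R).
Proof.
exists (e.+1`_p^')%N.
  by rewrite prime_coprime// -p'natE// part_pnat.
set v := logn p e.+1.
have ev : (v <= e)%N.
  rewrite -ltnS; apply: leq_trans (ltn_expl v (prime_gt1 p_pr)) _.
  by rewrite -p_part dvdn_leq// dvdn_part.
have -> : (e.+1`_p^')%N%:R * (p%:R ^+ e / e.+1%:R) = p%:R ^+ (e - v) :> R.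
  have E : (p%:R ^+ v * (e.+1`_p^')%N%:R = e.+1%:R :> R).
    by rewrite -natrX -natrM -p_part partnC.
  have p0 : p%:R != 0 :> R by rewrite pnatr_eq0 -lt0n prime_gt0.
  have e0 : e.+1%:R != 0 :> R by rewrite pnatr_eq0.
  apply: (mulfI (expf_neq0 v p0)); rewrite -exprD subnKC// [LHS]mulrA E.
  by field.
by rewrite -natrX rpred_nat.
Qed.

(** Multiplied by p^n, the recursion for B_n(x) expresses p^n B_n(x) by (px)^n
    and the p^k B_k(x) with k < n; the coefficients are binomials times
    p^e / (e + 1) with e = n - k. *)
Lemma loc_int_bernoulli (B : nat -> {poly R}) n j : is_bernoulli_poly B ->
  loc_int (p%:R ^+ n * (B n).[j%:R / p%:R]).
Proof.
move=> hB; have p0 : p%:R != 0 :> R by rewrite pnatr_eq0 -lt0n prime_gt0.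
have [N] := ubnP n; elim: N n => // N IH n nN.
have -> : p%:R ^+ n * (B n).[j%:R / p%:R] = j%:R ^+ n -
    \sum_(k < n) 'C(n, k)%:R * (p%:R ^+ (n - k) / (n - k).+1%:R) *
      (p%:R ^+ k * (B k).[j%:R / p%:R]).
  have := bernoulli_rec hB n (j%:R / p%:R).
  rewrite big_ord_recr/= binSn => /eqP; rewrite eq_sym -subr_eq => /eqP E.
  have n0 : n.+1%:R != 0 :> R by rewrite pnatr_eq0.
  have -> : j%:R ^+ n = p%:R ^+ n * (j%:R / p%:R) ^+ n :> R.
    by rewrite expr_div_n; field; rewrite expf_neq0.
  rewrite [X in _ - X](_ : _ = p%:R ^+ n / n.+1%:R *
    \sum_(k < n) 'C(n.+1, k)%:R * (B k).[j%:R / p%:R]); first by rewrite -E; field.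
  rewrite mulr_sumr; apply: eq_bigr => k _.
  have kn : (k <= n)%N by exact: ltnW.
  have := congr1 (fun a : nat => a%:R : R) (mul_bin_down n.+1 k).
  rewrite /= !natrM subSn// => E2.
  have -> : p%:R ^+ n = p%:R ^+ k * p%:R ^+ (n - k) :> R by rewrite -exprD subnKC.
  have d0 : (n - k).+1%:R != 0 :> R by rewrite pnatr_eq0.
  apply: (mulfI d0).
  transitivity (p%:R ^+ k * p%:R ^+ (n - k) / n.+1%:R *
      ((n.+1%:R * 'C(n, k)%:R) * (B k).[j%:R / p%:R])); first by
    field; rewrite ?d0 ?nat1r ?natr1 ?n0.
  by rewrite E2; ring.
rewrite -mulN1r; apply: loc_intD; first by rewrite -natrX; exact/loc_int_int/rpred_nat.
apply: loc_intM; first by apply: loc_int_int; rewrite rpredN rpred1.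
apply: loc_int_sum => k _; apply: loc_intM; last by apply: IH; have := ltn_ord k; lia.
apply: loc_intM; first exact/loc_int_int/rpred_nat.
exact: loc_int_expr_div.
Qed.

(** A denominator that is both prime to p and a power of p is 1. *)
Lemma loc_int_intP x e : loc_int x -> p%:R ^+ e * x \is a Num.int -> x \is a Num.int.
Proof.
move=> [M pM Mx] px.
have M0 : (0 < M)%N.
  by rewrite lt0n; apply: contraTneq pM => ->; rewrite /coprime gcdn0 gtn_eqF// prime_gt1.
have [u v uv _] := egcdnP (p ^ e)%N M0.
have : coprime M (p ^ e) by rewrite coprime_sym coprimeXl.
rewrite /coprime => /eqP g1; rewrite g1 in uv.
have -> : x = u%:R * (M%:R * x) - v%:R * (p%:R ^+ e * x).
  by rewrite !mulrA -natrX -!natrM uv natrD; ring.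
by apply: rpredB; apply: rpredM; rewrite ?rpred_nat.
Qed.

End LocalIntegrality.

Section CyclotomicIntegers.
Variables (R : realType) (p : nat) (z : R[i]).
Hypotheses (p_pr : prime p) (zp : p.-primitive_root z).
Implicit Types u v : R[i].

(** The ring Z[z]. *)
Definition zint u := exists f : {poly int}, u = (map_poly intr f).[z].

Lemma zint_intr (a : int) : zint a%:~R.
Proof. by exists a%:P; rewrite map_polyC hornerC. Qed.

Lemma zint_exp k : zint (z ^+ k).
Proof. by exists 'X^k; rewrite map_polyXn hornerXn. Qed.

Lemma zintD u v : zint u -> zint v -> zint (u + v).
Proof. by move=> [f ->] [g ->]; exists (f + g); rewrite rmorphD hornerD. Qed.

Lemma zintM u v : zint u -> zint v -> zint (u * v).
Proof. by move=> [f ->] [g ->]; exists (f * g); rewrite rmorphM hornerM. Qed.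

Lemma zintX u n : zint u -> zint (u ^+ n).
Proof.
move=> zu; elim: n => [|n IH]; first exact: (zint_intr 1).
by rewrite exprS; exact: zintM.
Qed.

Lemma zint_sum (I : Type) (s : seq I) (P : pred I) (f : I -> R[i]) :
  (forall i, P i -> zint (f i)) -> zint (\sum_(i <- s | P i) f i).
Proof.
by move=> H; apply: big_ind => //; [exact: (zint_intr 0)|exact: zintD].
Qed.

(** For w^p = 1, p = (w - 1) (w + 2 w^2 + ... + (p-1) w^(p-1)). *)
Lemma zint_p_geom j : ~~ (p %| j)%N -> zint (p%:R * (z ^+ j - 1)^-1).
Proof.
move=> pj; set w := z ^+ j; have wp : p.-primitive_root w by exact: primitive_root_exp.
have w1 : w - 1 != 0 by rewrite subr_eq0 -(prim_order_dvd zp).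
have -> : p%:R * (w - 1)^-1 = \sum_(i < p) i%:R * w ^+ i.
  apply: (mulIf w1); rewrite divfK//.
  have H n : (\sum_(i < n) i%:R * w ^+ i) * (w - 1) = n%:R * w ^+ n - \sum_(i < n) w ^+ i.+1.
    elim: n => [|n IH]; first by rewrite !big_ord0 mul0r mul0r subrr.
    by rewrite !big_ord_recr/= mulrDl IH exprS -natr1; ring.
  rewrite H (prim_expr_order wp) mulr1.
  under eq_bigr do rewrite exprS.
  rewrite -mulr_sumr; have := horner_geom_sum p_pr wp.
  rewrite geom_sumE horner_sum; under eq_bigr do rewrite hornerXn.
  by move=> ->; rewrite mulr0 subr0.
apply: zint_sum => i _; apply: zintM; first by rewrite pmulrn; exact: zint_intr.
by apply: zintX; exact: zint_exp.
Qed.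

Lemma zint_horner (q : {poly int}) n u : (size q <= n.+1)%N -> zint (p%:R * u) ->
  zint (p%:R ^+ n * (map_poly intr q).[u]).
Proof.
move=> sq pu.
rewrite (horner_coef_wide (n := n.+1)); last by apply: leq_trans sq; exact: size_poly.
rewrite mulr_sumr; apply: zint_sum => i _; rewrite coef_map /=.
have i_n : (i <= n)%N by rewrite -ltnS.
have -> : p%:R ^+ n * ((q`_i)%:~R * u ^+ i) = (q`_i)%:~R * p%:R ^+ (n - i) * (p%:R * u) ^+ i.
  have -> : p%:R ^+ n = p%:R ^+ (n - i) * p%:R ^+ i :> R[i] by rewrite -exprD subnK.
  by rewrite exprMn; ring.
apply: zintM; last exact: zintX.
by apply: zintM; [|apply: zintX; rewrite pmulrn]; exact: zint_intr.
Qed.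

(** A rational number in Z[z] is an integer: its expression h(z) by a polynomial
    of degree less than p - 1 is unique, so h is constant. Rationality
    of t enters through the multiple M t, which avoids dividing polynomials. *)
Lemma zint_rat_int (t : R) (M : nat) : (0 < M)%N -> M%:R * t \is a Num.int ->
  zint t%:C%C -> t \is a Num.int.
Proof.
move=> M0 /intrP[c Mt] [f ft].
pose g := Pdiv.Ring.rdivp f (geom_sum p int); pose h := Pdiv.Ring.rmodp f (geom_sum p int).
have fE : f = g * geom_sum p int + h by exact: Pdiv.RingMonic.rdivp_eq (geom_sum_monic p_pr _) _.
have hsz : (size h < p)%N.
  rewrite -[X in (_ < X)%N](size_geom_sum p_pr int) Pdiv.Ring.ltn_rmodpN0//.
  by rewrite monic_neq0// geom_sum_monic.
have hz : (map_poly intr h).[z] = t%:C%C.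
  by rewrite ft fE rmorphD rmorphM/= hornerD hornerM map_geom_sum horner_geom_sum// mulr0 add0r.
have [|k kE] := geom_sum_int_dvd p_pr (f := M%:Z%:P * h - c%:P) zp.
  rewrite rmorphB rmorphM/= !map_polyC/= !hornerE hz -pmulrn.
  rewrite -(rmorph_nat (real_complex R)) -rmorphM/= Mt.
  by rewrite -(rmorph_int (real_complex R)) subrr.
have k0 : k = 0.
  apply/eqP; apply: contraTT hsz => k0; rewrite -leqNgt.
  have : (size (M%:Z%:P * h - c%:P)%R <= maxn (size h) 1)%N.
    apply: leq_trans (size_polyD _ _) _; rewrite size_polyN geq_max !leq_max.
    rewrite size_polyC_leq1 orbT andbT mul_polyC; apply/orP; left; exact: size_scale_leq.
  rewrite kE size_Mmonic ?geom_sum_monic// size_geom_sum//.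
  have := prime_gt1 p_pr; have : (0 < size k)%N by rewrite size_poly_gt0.
  rewrite leq_max; move: (size k) (size h) => a b a0 p1 /orP[]; lia.
move: kE; rewrite k0 mul0r => /(congr1 (fun q : {poly int} => q`_0)).
rewrite mul_polyC coefB coefZ coefC coef0 eqxx => /eqP; rewrite subr_eq0 => /eqP hc.
suff -> : t = (h`_0)%:~R by exact: intr_int.
have M0' : M%:R != 0 :> R by rewrite pnatr_eq0 -lt0n.
by apply: (mulfI M0'); rewrite Mt -hc rmorphM.
Qed.

End CyclotomicIntegers.

(** * Comparison of the cotangent and Bernoulli sums *)

Section GaussTransform.
Variables (R : realType) (B : nat -> {poly R}) (p r : nat).
Hypotheses (hB : is_bernoulli_poly B) (p_pr : prime p) (p_gt2 : (2 < p)%N).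
Hypothesis r_gt0 : (0 < r)%N.

Let z : R[i] := zeta R p.
Let zp : p.-primitive_root z := zeta_primitive R p_pr p_gt2.
Let G : R[i] := (map_poly intr (gauss_poly p)).[z].
Let chi (j : nat) : int := legendre j p.
Let x j : R := pi * j%:R / p%:R.
Let p0 : p%:R != 0 :> R. Proof. by rewrite pnatr_eq0 -lt0n prime_gt0. Qed.

Definition bernoulli_sum : R :=
  \sum_(1 <= k < p) (legendre k p)%:~R * (B r.+1).[k%:R / p%:R].

Definition cot_sum : R :=
  \sum_(1 <= j < p) (legendre j p)%:~R * (cot_poly R r).[cot (pi * j%:R / p%:R)].

Let ndvd j : (0 < j < p)%N -> ~~ (p %| j)%N.
Proof. by move=> /andP[j0 jp]; rewrite gtnNdvd. Qed.

Lemma zeta_exp_geom j : (0 < j < p)%N ->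
  (z ^+ j - 1)^-1 = - 2^-1 - 'i%C / 2 * (cot (pi * j%:R / p%:R))%:C%C.
Proof.
move=> jp; have -> : z ^+ j = cis (x j *+ 2).
  rewrite /z /zeta -cisMn; congr cis; rewrite -[LHS]mulr_natr -[RHS]mulr_natr /x.
  by field.
by rewrite inv_cis2_sub1// gt_eqF// sin_pi_frac_gt0.
Qed.

(** The inner sum over j of chi(j) z^(jk) is chi(k) G, also for k = 0 where both
    are 0. *)
Lemma gauss_bernoulli_sum :
  G * (p%:R ^+ r.+1 * bernoulli_sum)%:C%C = r.+1%:R * p%:R *
  \sum_(1 <= j < p) (chi j)%:~R * (geom_poly R[i] r).[(z ^+ j - 1)^-1].
Proof.
have D j : (0 < j < p)%N -> r.+1%:R * p%:R * (geom_poly R[i] r).[(z ^+ j - 1)^-1] =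
    p%:R ^+ r.+1 * \sum_(0 <= k < p) ((B r.+1).[k%:R / p%:R])%:C%C * z ^+ j ^+ k.
  move=> jp; rewrite (bernoulli_dft hB (real_complex R))// ?prime_gt0//.
    by rewrite -(prim_order_dvd zp) ndvd.
  by rewrite exprAC (prim_expr_order zp) expr1n.
rewrite mulr_sumr.
transitivity (p%:R ^+ r.+1 * \sum_(0 <= k < p) ((B r.+1).[k%:R / p%:R])%:C%C *
    (\sum_(1 <= j < p) (chi j)%:~R * (z ^+ k) ^+ j)); last first.
  rewrite [RHS]big_nat.
  rewrite [RHS](eq_bigr (fun j => p%:R ^+ r.+1 * \sum_(0 <= k < p)
     (chi j)%:~R * (((B r.+1).[k%:R / p%:R])%:C%C * z ^+ j ^+ k))); last first.
    by move=> j jp; rewrite mulrCA D// mulrCA; congr (_ * _); rewrite mulr_sumr.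
  rewrite -big_nat -mulr_sumr; congr (_ * _); rewrite exchange_big /=.
  apply: eq_bigr => k _; rewrite mulr_sumr; apply: eq_bigr => j _.
  by rewrite mulrCA exprAC.
have gs k : (k < p)%N -> \sum_(1 <= j < p) (chi j)%:~R * (z ^+ k) ^+ j = (chi k)%:~R * G.
  move=> kp; rewrite (big_legendre p_pr (fun j => (z ^+ k) ^+ j)).
  have [->|k0] := posnP k.
    rewrite /chi legendre0 mul0r; under eq_bigr do rewrite expr1n mulr1.
    by rewrite -(rmorph_sum (intr : int -> R[i])) sum_legendre0.
  by rewrite -horner_gauss_poly// gauss_scale// ndvd// k0.
rewrite rmorphM rmorphXn/= rmorph_nat mulrCA; congr (_ * _).
rewrite [RHS]big_nat [RHS](eq_bigr (fun k =>
  G * (((chi k)%:~R * (B r.+1).[k%:R / p%:R])%:C%C))).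
  rewrite -big_nat -mulr_sumr; congr (_ * _).
  rewrite [RHS]big_ltn ?prime_gt0// /chi legendre0 mul0r rmorph0 add0r.
  by rewrite rmorph_sum.
move=> k /andP[_ kp]; rewrite gs// rmorphM rmorph_int /=; ring.
Qed.

Lemma sum_geom_cot :
  \sum_(1 <= j < p) (chi j)%:~R * (geom_poly R[i] r).[(z ^+ j - 1)^-1] =
  - ('i%C / 2) * ('i%C / 2) ^+ r * cot_sum%:C%C.
Proof.
rewrite /cot_sum rmorph_sum mulr_sumr /= !big_nat; apply: eq_bigr => j jp.
by rewrite zeta_exp_geom// geom_poly_cot// rmorphM rmorph_int /=; ring.
Qed.

Lemma Ssum_cot_sum :
  Ssum R r p = (-1) ^+ (p./2 + r).+1 * (Num.sqrt p%:R / 2 ^+ (r + 2)) * cot_sum.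
Proof.
rewrite /Ssum legendreN1// rmorphXn rmorphN1 /=.
rewrite (_ : \sum_(1 <= j < p) _ = (-1) ^+ r * cot_sum).
  by rewrite [(-1) ^+ _.+1]exprS [(-1) ^+ (_ + _)]exprD mulN1r; ring.
rewrite /cot_sum mulr_sumr !big_nat; apply: eq_bigr => j jp.
by rewrite derive1n_cot ?gt_eqF ?sin_pi_frac_gt0//; ring.
Qed.

(** The polynomial in the cotangent has parity (-1)^(r+1), and
    chi(p - j) = (-1)^m chi(j). *)
Lemma cot_term_reflect j : (0 < j < p)%N ->
  (chi (p - j))%:~R * (cot_poly R r).[cot (x (p - j))] =
  (-1) ^+ (p./2 + r).+1 * ((chi j)%:~R * (cot_poly R r).[cot (x j)]).
Proof.
move=> /andP[j0 jp]; rewrite /chi legendre_opp// 1?ltnW// legendreN1//.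
have -> : cot (x (p - j)) = - cot (x j).
  have -> : x (p - j) = pi - x j.
    by rewrite /x natrB; [field|exact: ltnW].
  by rewrite /cot cosB sinB cospi sinpi !mul0r addr0 sub0r !mulN1r opprK mulNr.
rewrite cot_poly_opp// rmorphM rmorphXn rmorphN1 /=.
by rewrite -addnS exprD; ring.
Qed.

Lemma cot_sum_reflect : cot_sum = (-1) ^+ (p./2 + r).+1 * cot_sum.
Proof.
rewrite {1}/cot_sum big_nat_rev/= /cot_sum mulr_sumr !big_nat; apply: eq_bigr => j jp.
have -> : (1 + p - j.+1 = p - j)%N by lia.
exact: cot_term_reflect.
Qed.

Let rr0 : r.+1%:R != 0 :> R. Proof. by rewrite pnatr_eq0. Qed.
Let G0 : G != 0.
Proof.
apply/eqP => g0; have := gauss_sqr p_pr p_gt2 zp; rewrite -/G g0 expr0n /= => /esym/eqP.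
by rewrite mulf_eq0 legendreN1// rmorphXn rmorphN1 signr_eq0 pnatr_eq0 gtn_eqF ?prime_gt0.
Qed.
Let i0 : 'i%C != 0 :> R[i].
Proof. by rewrite eq_complex /= oner_eq0 andbF. Qed.
Let sqrtp0 : Num.sqrt p%:R != 0 :> R.
Proof. by rewrite gt_eqF// sqrtr_gt0 ltr0n prime_gt0. Qed.
Let sqrtp2 : Num.sqrt p%:R ^+ 2 = p%:R :> R.
Proof. by rewrite sqr_sqrtr. Qed.

Lemma bernoulli_cot_sum :
  G * (p%:R ^+ r.+1 * bernoulli_sum)%:C%C =
  r.+1%:R * p%:R * (- ('i%C / 2) * ('i%C / 2) ^+ r * cot_sum%:C%C).
Proof. by rewrite gauss_bernoulli_sum sum_geom_cot. Qed.

Lemma Tsum_bernoulli_sum :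
  Tsum B r p = (-1) ^+ (r.-1 %/ 2) * (p%:R ^+ r.+1 / (2 * r.+1%:R)) * bernoulli_sum.
Proof. by rewrite /Tsum addn1 subn1. Qed.

(** The cotangent sum equals its opposite, and the Gauss sum is nonzero. *)
Lemma Tsum_odd : odd (p./2 + r).+1 -> Tsum B r p = 0.
Proof.
move=> e; have := cot_sum_reflect; rewrite -signr_odd e mulN1r => /eqP.
rewrite -addr_eq0 -mulr2n mulrn_eq0 /= => /eqP c0.
have := bernoulli_cot_sum; rewrite c0 rmorph0 !mulr0 => /eqP.
rewrite mulf_eq0 (negbTE G0) /= -(rmorph0 (real_complex R)) (inj_eq (@complexI R)).
rewrite mulf_eq0 expf_eq0 (negbTE p0) /= => /eqP b0.
by rewrite Tsum_bernoulli_sum b0 mulr0.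
Qed.

Lemma Ssum_odd : odd (p./2 + r).+1 -> Ssum R r p = 0.
Proof.
move=> e; have := cot_sum_reflect; rewrite -signr_odd e mulN1r => /eqP.
by rewrite -addr_eq0 -mulr2n mulrn_eq0 /= => /eqP c0; rewrite Ssum_cot_sum c0 mulr0.
Qed.

Lemma Ssum_even : ~~ odd (p./2 + r).+1 ->
  Ssum R r p = Num.sqrt p%:R / 2 ^+ (r + 2) * cot_sum.
Proof. by move=> e; rewrite Ssum_cot_sum -signr_odd (negbTE e) mul1r. Qed.

Let half_i_exp q : ('i%C / 2) ^+ q.*2 = ((-1) ^+ q / 4 ^+ q)%:C%C :> R[i].
Proof.
have -> : (-1) ^+ q / 4 ^+ q = (- 4^-1) ^+ q :> R by rewrite [RHS]exprNn exprVn.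
rewrite -mul2n exprM (rmorphXn (real_complex R)) /=; congr (_ ^+ q).
rewrite exprMn sqr_i rmorphN fmorphV /= (rmorph_nat (real_complex R)).
by rewrite mulN1r exprVn -natrX.
Qed.

(** The constant of [bernoulli_cot_sum] has the same argument, real or
    imaginary, as the Gauss sum; cancelling it leaves an identity of real
    numbers. *)
Let Tsum_cot (K : R) :
  - ('i%C / 2) * ('i%C / 2) ^+ r = (if odd p./2 then 'i%C else 1) * K%:C%C ->
  Tsum B r p = (-1) ^+ (r.-1 %/ 2) * K * (Num.sqrt p%:R / 2) * cot_sum.
Proof.
move=> KE; have := bernoulli_cot_sum; rewrite /G gauss_value// KE.
set u := if _ then _ else _.
have u0 : u != 0 by rewrite /u; case: ifP; rewrite ?oner_eq0.
rewrite -!(rmorph_nat (real_complex R)) => E.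
have {}E : (Num.sqrt p%:R * (p%:R ^+ r.+1 * bernoulli_sum))%:C%C =
    (r.+1%:R * p%:R * (K * cot_sum))%:C%C :> R[i].
  by apply: (mulfI u0); rewrite !(rmorphM (real_complex R)) /= in E *; ring: E.
move/complexI: E; rewrite Tsum_bernoulli_sum; move: (p%:R ^+ r.+1 : R) rr0 => P n0.
rewrite -{2}sqrtp2 => E.
have Pb : P * bernoulli_sum = r.+1%:R * Num.sqrt p%:R * (K * cot_sum).
  by apply: (mulfI sqrtp0); rewrite E; ring.
transitivity ((-1) ^+ (r.-1 %/ 2) / (2 * r.+1%:R) * (P * bernoulli_sum)); first by ring.
by rewrite Pb; field; rewrite ?natr1 ?nat1r.
Qed.

Lemma Tsum_even : ~~ odd (p./2 + r).+1 ->
  Tsum B r p = Num.sqrt p%:R / 2 ^+ (r + 2) * cot_sum.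
Proof.
move=> e; have C4 : 4^-1 = (4^-1)%:C%C :> R[i].
  by rewrite fmorphV /= (rmorph_nat (real_complex R)).
have sg q : (-1) ^+ q * (-1) ^+ q = 1 :> R by rewrite -expr2 sqrr_sign.
have F q : (2 : R) ^+ q.*2 = 4 ^+ q by rewrite -mul2n exprM -natrX.
have rE := odd_double_half r; set q := r./2 in rE.
have four0 : (4 : R) ^+ q != 0 by rewrite expf_neq0 ?pnatr_eq0.
have [ro|re] := boolP (odd r).
  have mo : odd p./2 = false.
    by apply: negbTE; move: e; rewrite /= oddD ro negbK; case: (odd _).
  rewrite ro add1n in rE.
  rewrite (Tsum_cot (K := 4^-1 * ((-1) ^+ q / 4 ^+ q))); last first.
    rewrite mo mul1r -rE exprS half_i_exp mulrA
      [in RHS](rmorphM (real_complex R)) /= -C4; congr (_ * _).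
    transitivity (- ('i%C ^+ 2) / 4 : R[i]); first by field.
    by rewrite sqr_i opprK mul1r.
  rewrite -rE /= divn2 doubleK addSn exprS exprD F.
  transitivity (((-1) ^+ q * (-1) ^+ q) * (8^-1 / 4 ^+ q * Num.sqrt p%:R * cot_sum)).
    by field.
  by rewrite sg; field.
have mo : odd p./2 by move: e; rewrite /= oddD (negbTE re) addbF negbK.
rewrite (negbTE re) add0n in rE.
have q0 : (0 < q)%N by rewrite -double_gt0 rE.
rewrite (Tsum_cot (K := - 2^-1 * ((-1) ^+ q / 4 ^+ q))); last first.
  rewrite mo -rE half_i_exp [in RHS](rmorphM (real_complex R)) rmorphN fmorphV /=.
  by rewrite (rmorph_nat (real_complex R)); ring.
have -> : (r.-1 %/ 2 = q.-1)%N.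
  by rewrite -rE; case: (q) q0 => // k _; rewrite doubleS divn2 /= uphalf_double.
rewrite -rE exprD F.
have -> : (-1) ^+ q = - (-1) ^+ q.-1 :> R by case: (q) q0 => // k _; rewrite exprS mulN1r.
transitivity (((-1) ^+ q.-1 * (-1) ^+ q.-1) * (4^-1 / 4 ^+ q * Num.sqrt p%:R * cot_sum)).
  by field.
by rewrite sg; field.
Qed.

End GaussTransform.

(** * Nonnegativity and integrality *)

Section Positivity.
Variables (R : realType) (p r : nat).
Hypotheses (p_pr : prime p) (p_gt2 : (2 < p)%N) (r_gt0 : (0 < r)%N).
Hypothesis parity : ~~ odd (p./2 + r).+1.

Let podd : odd p.
Proof. by case: (even_prime p_pr) p_gt2 => [->|]. Qed.
Let pE : p = p./2.*2.+1 := odd_prime_half p_pr p_gt2.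
Let x : R := pi / p%:R.
Let xE j : pi * j%:R / p%:R = j%:R * x.
Proof. by rewrite /x; ring. Qed.

Lemma cot_sum_half : cot_sum R p r =
  (\sum_(1 <= j < p./2.+1) (legendre j p)%:~R * (cot_poly R r).[cot (j%:R * x)]) *+ 2.
Proof.
rewrite /cot_sum (sum_symmetric podd).
  by congr (_ *+ 2); apply: eq_bigr => j _; rewrite xE.
by move=> j jp; rewrite cot_term_reflect// -signr_odd (negbTE parity) mul1r.
Qed.

(** Each term is 1 / sin^2(jx) times g(cot(jx)), where g increases with the
    cotangent. In the worst case all symbols for j >= 2 are -1, and then
    [sum_csc2_le] still leaves a nonnegative rest. *)
Lemma cot_sum_ge0 : 0 <= cot_sum R p r.
Proof.
have p_gt0 := prime_gt0 p_pr.
have x0 : 0 < x by rewrite divr_gt0 ?pi_gt0 ?ltr0n.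
have m0 : (0 < p./2)%N by have := p_gt2; rewrite pE; case: (p./2).
have mx : p./2%:R * x <= pi / 2.
  have -> : pi / 2 = (p%:R / 2) * x by rewrite /x; field; rewrite pnatr_eq0 -lt0n.
  rewrite ler_pM2r// ler_pdivlMr// -natrM ler_nat.
  by rewrite {2}pE muln2.
have sin_pos j : (0 < j <= p./2)%N -> 0 < sin (j%:R * x).
  by move=> jm; rewrite -xE sin_pi_frac_gt0//; have := pE; lia.
rewrite cot_sum_half mulrn_wge0// big_ltn// legendre1// !mul1r.
pose g := (cot_poly R r.-1)^`().
have gge0 i : 0 <= g`_i by rewrite coef_deriv mulrn_wge0// cot_poly_coef_ge0.
have WE j : (0 < j <= p./2)%N ->
    (cot_poly R r).[cot (j%:R * x)] = sin (j%:R * x) ^- 2 * g.[cot (j%:R * x)].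
  move=> jm; have -> : cot_poly R r = (1 + 'X^2) * g.
    by rewrite /g -[in LHS](prednK r_gt0).
  have h1 c : (1 + 'X^2 : {poly R}).[c] = 1 + c ^+ 2 by rewrite !hornerE.
  rewrite hornerM h1; congr (_ * _).
  have s0 : sin (j%:R * x) != 0 by rewrite gt_eqF// sin_pos.
  transitivity ((cos (j%:R * x) ^+ 2 + sin (j%:R * x) ^+ 2) / sin (j%:R * x) ^+ 2).
    by rewrite /cot; field.
  by rewrite cos2Dsin2 mul1r.
have gle j : (0 < j <= p./2)%N -> 0 <= g.[cot (j%:R * x)] <= g.[cot x].
  move=> jm; have /andP[c0 c1] := cot_decr x0 m0 mx jm.
  exact: ge0_coef_horner_mono.
have W1 := WE 1; rewrite mul1r in W1; rewrite W1 ?m0//.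
have g1 : 0 <= g.[cot x] by have := gle 1; rewrite mul1r m0 => /(_ isT)/andP[].
have tail j : (2 <= j < p./2.+1)%N ->
    - (sin (j%:R * x) ^- 2 * g.[cot x]) <=
    (legendre j p)%:~R * (cot_poly R r).[cot (j%:R * x)].
  move=> /andP[j2 jm]; have jm' : (0 < j <= p./2)%N by lia.
  rewrite WE//; have /andP[h0 h1] := gle j jm'.
  have s0 : 0 <= sin (j%:R * x) ^- 2 by rewrite invr_ge0 exprn_ge0// ltW// sin_pos.
  have T0 := mulr_ge0 s0 h0; have T1 := ler_wpM2l s0 h1; have T2 := mulr_ge0 s0 g1.
  have := legendre_values p j; rewrite !inE => /or3P[]/eqP->.
  - by rewrite mulN1r lerN2.
  - by rewrite mul0r oppr_le0.
  - by rewrite mul1r (le_trans _ T0)// oppr_le0.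
apply: (@le_trans _ _ (sin x ^- 2 * g.[cot x] +
    \sum_(2 <= j < p./2.+1) - (sin (j%:R * x) ^- 2 * g.[cot x]))).
  rewrite sumrN -mulr_suml -mulrBl mulr_ge0// subr_ge0.
  exact: sum_csc2_le.
by rewrite lerD2l !big_nat; apply: ler_sum => j jm; apply: tail.
Qed.

End Positivity.

Section Integrality.
Variables (R : realType) (B : nat -> {poly R}) (p r : nat).
Hypotheses (hB : is_bernoulli_poly B) (p_pr : prime p) (p_gt2 : (2 < p)%N).
Hypothesis r_gt0 : (0 < r)%N.

Lemma loc_int_Tsum : coprime p r.+1 -> loc_int p (Tsum B r p).
Proof.
move=> pr; have p0 : p%:R != 0 :> R by rewrite pnatr_eq0 -lt0n prime_gt0.
have : loc_int p (p%:R ^+ r.+1 * bernoulli_sum B p r).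
  rewrite /bernoulli_sum mulr_sumr; apply: loc_int_sum => k _; rewrite mulrCA.
  apply: loc_intM; first exact/loc_int_int/intr_int.
  exact: loc_int_bernoulli.
move=> [M pM Mi]; exists (M * (2 * r.+1))%N.
  rewrite !coprimeMr pM pr andbT /= prime_coprime//.
  by apply/negP => /dvdn_leq; have := p_gt2; lia.
rewrite Tsum_bernoulli_sum.
have -> : (M * (2 * r.+1))%:R * ((-1) ^+ (r.-1 %/ 2) * (p%:R ^+ r.+1 / (2 * r.+1%:R)) *
    bernoulli_sum B p r) = (-1) ^+ (r.-1 %/ 2) * (M%:R * (p%:R ^+ r.+1 * bernoulli_sum B p r)).
  by rewrite !natrM; field; rewrite ?natr1 ?nat1r pnatr_eq0.
by apply: rpredM => //; apply: rpredX; rewrite rpredN rpred1.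
Qed.

Lemma size_geom_poly s : (size (geom_poly int s) <= s.+2)%N.
Proof.
elim: s => [|s IH]; first by rewrite size_polyX.
rewrite /geom_poly iter_derivationS -/(geom_poly int s).
apply: leq_trans (size_polyMleq _ _) _.
have h1 : (size (- ('X + 'X^2) : {poly int}) <= 3)%N.
  rewrite size_polyN; apply: leq_trans (size_polyD _ _) _.
  by rewrite size_polyX size_polyXn.
have h2 : (size (geom_poly int s)^`() <= s.+1)%N.
  by apply: leq_trans (size_poly _ _) _; lia.
by rewrite -subn1 leq_subLR (leq_trans (leq_add h1 h2)).
Qed.

(** Pairing j with p - j removes the factor 1/2 of T. Multiplying by G and using
    G^2 = (-1)^m p then turns the quotient by G into a product, and p^(r+1)
    clears the denominators of E_r(y_j), whose degree is at most r + 1. *)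
Lemma zint_Tsum : ~~ odd (p./2 + r).+1 ->
  zint (zeta R p) (p%:R ^+ r.+1 * Tsum B r p)%:C%C.
Proof.
move=> parity; set z := zeta R p.
have zp : p.-primitive_root z := zeta_primitive R p_pr p_gt2.
have podd : odd p by case: (even_prime p_pr) p_gt2 => [->|].
pose G : R[i] := (map_poly intr (gauss_poly p)).[z].
have p0 : p%:R != 0 :> R[i] by rewrite pnatr_eq0 -lt0n prime_gt0.
have n0 : r.+1%:R != 0 :> R[i] by rewrite pnatr_eq0.
pose t (j : nat) : R[i] := (legendre j p)%:~R * (geom_poly R[i] r).[(z ^+ j - 1)^-1].
have tE j : (0 < j < p)%N -> t j = - ('i%C / 2) * ('i%C / 2) ^+ r *
    ((legendre j p)%:~R * (cot_poly R r).[cot (pi * j%:R / p%:R)])%:C%C.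
  move=> jp; rewrite /t zeta_exp_geom// geom_poly_cot// (rmorphM (real_complex R)).
  by rewrite (rmorph_int (real_complex R)) /=; ring.
pose H := \sum_(1 <= j < p./2.+1) t j.
have E : G * (p%:R ^+ r.+1 * bernoulli_sum B p r)%:C%C = r.+1%:R * p%:R * (H *+ 2).
  rewrite /G gauss_bernoulli_sum//; congr (_ * _).
  apply: (sum_symmetric (f := t) podd) => j jp; rewrite tE; last by lia.
  by rewrite cot_term_reflect// -signr_odd (negbTE parity) mul1r tE.
have TE : (Tsum B r p)%:C%C = (-1) ^+ (r.-1 %/ 2 + p./2) * (G * H).
  have G2 : G ^+ 2 = (-1) ^+ p./2 * p%:R.
    by rewrite /G gauss_sqr// legendreN1// rmorphXn rmorphN1.
  rewrite Tsum_bernoulli_sum.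
  have sg (n : nat) : (((-1) ^+ n : R)%:C%C) = (-1) ^+ n.
    by rewrite rmorphXn rmorphN1.
  have {}G2 : (-1) ^+ p./2 * G ^+ 2 = p%:R by rewrite G2 mulrA -expr2 sqrr_sign mul1r.
  have {}E : (p%:R ^+ r.+1 * bernoulli_sum B p r)%:C%C = (-1) ^+ p./2 * r.+1%:R * G * H *+ 2.
    have G0 : G != 0.
      by apply: contraNneq p0 => G0; rewrite -G2 G0 expr0n mulr0.
    apply: (mulfI G0); rewrite E -G2; ring.
  have -> : (-1) ^+ (r.-1 %/ 2) * (p%:R ^+ r.+1 / (2 * r.+1%:R)) * bernoulli_sum B p r =
      (-1) ^+ (r.-1 %/ 2) * (2 * r.+1%:R)^-1 * (p%:R ^+ r.+1 * bernoulli_sum B p r) by ring.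
  rewrite (rmorphM (real_complex R)) /= E (rmorphM (real_complex R)) /= sg.
  rewrite fmorphV (rmorphM (real_complex R)) /= !(rmorph_nat (real_complex R)).
  by rewrite exprD; field; rewrite ?natr1 ?nat1r.
rewrite (rmorphM (real_complex R)) (rmorphXn (real_complex R)) /=
  (rmorph_nat (real_complex R)) TE.
rewrite mulrCA; apply: zintM.
  by rewrite -signr_odd; case: (odd _); [exact: (zint_intr z (-1))|exact: (zint_intr z 1)].
rewrite mulrCA; apply: zintM; first by exists (gauss_poly p).
rewrite /H mulr_sumr big_nat; apply: zint_sum => j jm.
rewrite mulrCA; apply: zintM; first exact: zint_intr.
have -> : geom_poly R[i] r = map_poly intr (geom_poly int r).
  rewrite /geom_poly map_iter_derivation; congr iter_derivation.
  by rewrite rmorphN rmorphD /= map_polyX map_polyXn.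
apply: zint_horner; first exact: size_geom_poly.
apply: zint_p_geom => //; rewrite gtnNdvd//; first by lia.
by have := odd_double_half p; rewrite podd; lia.
Qed.

Lemma Tsum_int : coprime p r.+1 -> ~~ odd (p./2 + r).+1 -> Tsum B r p \is a Num.int.
Proof.
move=> pr parity; have lT := loc_int_Tsum pr.
apply: (loc_int_intP p_pr (e := r.+1) lT).
have [M pM Mi] := lT.
have M0 : (0 < M)%N.
  by rewrite lt0n; apply: contraTneq pM => ->; rewrite /coprime gcdn0 gtn_eqF// prime_gt1.
apply: (zint_rat_int p_pr (zeta_primitive R p_pr p_gt2) M0 _ (zint_Tsum parity)).
by rewrite mulrCA; apply: rpredM => //; apply: rpredX; exact: rpred_nat.
Qed.

End Integrality.

Theorem proposition3p1 (R : realType) (B : nat -> {poly R})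
    (hB : is_bernoulli_poly B) (p r : nat) (p_prime : prime p)
    (p_ge5 : (5 <= p)%N) (r_gt0 : (0 < r)%N)
    (hpr : coprime p (r + 1)) :
  [/\ Ssum R r p \is a Num.nat,
      Tsum B r p \is a Num.nat
    & Ssum R r p = Tsum B r p].
Proof.
have p_gt2 : (2 < p)%N by exact: leq_trans p_ge5.
rewrite addn1 in hpr.
have [e|e] := boolP (odd (p./2 + r).+1).
  by rewrite Ssum_odd// Tsum_odd// rpred0.
have ST : Ssum R r p = Tsum B r p by rewrite Ssum_even// Tsum_even.
have Tnat : Tsum B r p \is a Num.nat.
  rewrite natrEint Tsum_int//= -ST Ssum_even//.
  by rewrite mulr_ge0 ?cot_sum_ge0// divr_ge0 ?sqrtr_ge0// exprn_ge0.
by split; rewrite ?ST.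
Qed.
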